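(* For all real $b,c>1$, the sets \[ \widetilde{\Xi}(b,c)=\{\xi\in\mathfrak{F}: c^{b^n}\le\|a_n(\xi)\|\text{ for all }n\in\mathbb{N}\},\qquad \Xi(b,c)=\{\xi\in\mathfrak{F}: c^{b^n}\le\|a_n(\xi)\|\text{ for infinitely many }n\in\mathbb{N}\} \] satisfy $\dim_H\Xi(b,c)=\dim_H\widetilde{\Xi}(b,c)=\frac{2}{b+1}$.
   Context: For $z\in\mathbb{C}$ let $\|z\|:=\max\{|\Re z|,|\Im z|\}$, $[z]:=\lfloor \Re z+\tfrac12\rfloor+i\lfloor \Im z+\tfrac12\rfloor$ and $\mathfrak{F}:=\{z\in\mathbb{C}:[z]=0\}$. The complex Gauss map is $T(z)=z^{-1}-[z^{-1}]$ ($z\ne0$), $T(0)=0$, and the Hurwitz continued fraction partial quotients are $a_1(z)=[z^{-1}]$, $a_n(z)=a_1(T^{n-1}(z))$ (defined while $T^{n-1}(z)\ne0$). $\dim_H$ is Hausdorff dimension. *)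

(* Defs.v *)
From HB Require Import structures.
From mathcomp Require Import all_boot all_order all_algebra.
From mathcomp Require Import all_classical all_reals all_analysis.
From mathcomp Require Import complex.

Set Implicit Arguments.
Unset Strict Implicit.
Unset Printing Implicit Defensive.

Import Order.TTheory GRing.Theory Num.Theory.

Local Open Scope classical_set_scope.
Local Open Scope ring_scope.

(* Hausdorff dimension of a subset of T, for the metric dist on T. *)
Section Hausdorff.
Context {R : realType} {T : Type} (dist : T -> T -> R).
Implicit Types (A : set T) (s delta : R).

(* The case split is needed because ereal_sup set0 = -oo. *)
Definition diameter A : \bar R :=
  if `[< A = set0 >] then 0%E
  else ereal_sup [set (dist p.1 p.2)%:E | p in A `*` A].

(* |A|^s, with |set0|^s = 0 and 0^0 = 1 for nonempty A, so that s = 0 gives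
   counting measure. *)
Definition diameter_pow s A : \bar R :=
  if `[< A = set0 >] then 0%E else poweR (diameter A) s.

Definition delta_cover delta A (U : nat -> set T) : Prop :=
  A `<=` \bigcup_i U i /\ forall i, (diameter (U i) <= delta%:E)%E.

Definition hausdorff_premeasure s delta A : \bar R :=
  ereal_inf [set (\sum_(i <oo) diameter_pow s (U i))%E
            | U in delta_cover delta A].

(* The supremum over delta > 0 is the limit as delta -> 0+, since
   hausdorff_premeasure is nonincreasing in delta. *)
Definition hausdorff_measure s A : \bar R :=
  ereal_sup [set hausdorff_premeasure s delta A | delta in [set d : R | 0 < d]].

Definition hausdorff_dim A : \bar R :=
  ereal_inf [set s%:E | s in [set s : R | 0 <= s /\ hausdorff_measure s A = 0%E]].

End Hausdorff.

Section Hurwitz.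
Context {R : realType}.
Local Notation C := (R[i]).
Implicit Types (z xi : C) (b c : R).

Definition cdist (z w : C) : R := Normc.normc (z - w).

Definition maxnorm z : R := Num.max `|complex.Re z| `|complex.Im z|.

Definition near_gint z : C :=
  Complex (Num.floor (complex.Re z + 2^-1))%:~R
          (Num.floor (complex.Im z + 2^-1))%:~R.

Definition hurwitz_domain : set C := [set z | near_gint z = 0].

Definition gauss_map z : C := if z == 0 then 0 else z^-1 - near_gint z^-1.

(* pquot n z is a_n(z), for n >= 1; it is meaningful only when
   pquot_defined n z holds. *)
Definition pquot_defined (n : nat) z : Prop := iter n.-1 gauss_map z != 0.

Definition pquot (n : nat) z : C := near_gint (iter n.-1 gauss_map z)^-1.

Definition large_pquot b c (n : nat) xi : Prop :=
  pquot_defined n xi /\ c `^ (b ^+ n) <= maxnorm (pquot n xi).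

Definition Xi_all b c : set C :=
  [set xi | hurwitz_domain xi /\
            forall n : nat, (1 <= n)%N -> large_pquot b c n xi].

Definition Xi_io b c : set C :=
  [set xi | hurwitz_domain xi /\
            infinite_set [set n : nat | (1 <= n)%N /\ large_pquot b c n xi]].

End Hurwitz.

(* Main.v *)
Require Import Defs.
From mathcomp Require Import all_boot all_order all_algebra.
From mathcomp Require Import all_classical all_reals all_analysis.
From mathcomp Require Import complex.
From mathcomp Require Import ring lra zify.

(* Let z_k = T^k z. Two points with the same first digit satisfy
   |z - w| = |z| |w| |T z - T w|, so the diameter of a cylinder is controlled, up to
   a factor 4^n, by the product of the |a_k|^-2, and no convergents are needed.

   Upper bound. Let s > 2/(b+1) and 1 < b' < b with (b'+1) s > 2. If
   ||a_n|| >= c^(b^n) infinitely often then, for every G, infinitely often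
   ||a_{n+1}|| >= (||a_1|| ... ||a_n||)^(b'-1) G^n, since otherwise the sums of
   ln ||a_k|| would grow more slowly than b^n. The points of the cylinder of
   a_1 ... a_n with this property form a set of diameter at most
   4 prod_k (4/G) ||a_k||^-(b'+1), and for G large the s-th powers of these numbers,
   over all words of length n, add up to at most 4^s 2^-n.

   Lower bound. Take all points whose digits a_k have both coordinates in
   [N_k, 2 N_k), with N_k comparable to c^(b^k), and give each digit block of length n
   the mass prod_k N_k^-2. A set of diameter d, where d lies between the gaps of
   consecutive levels, meets at most min(N_m^2, 9 (d/gap)^2) cylinders of the finer
   level, and interpolating between the two bounds gives mass at most K d^s for
   s < 2/(b+1). If sets of small total d^s covered everything, always descending to a
   child less than fully covered would produce a point missed by all of them. *)

Set Implicit Arguments.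
Unset Strict Implicit.
Unset Printing Implicit Defensive.

Import Order.TTheory GRing.Theory Num.Theory.

Local Open Scope classical_set_scope.
Local Open Scope ring_scope.

(** * Criteria for upper and lower bounds on Hausdorff dimension *)

Section HausdorffBounds.
Context {R : realType} {T : Type} (dist : T -> T -> R).
Hypothesis dist_ge0 : forall x y, 0 <= dist x y.
Implicit Types (A U : set T) (s d : R).

Lemma diameter_ge0 U : (0 <= diameter dist U)%E.
Proof.
rewrite /diameter; case: asboolP => // /eqP/set0P [x Ux].
by apply: le_ereal_sup_tmp; exists (dist x x)%:E; [exists (x, x) | rewrite lee_fin].
Qed.

Lemma diameter_le U d : 0 <= d ->
  (forall x y, U x -> U y -> dist x y <= d) -> (diameter dist U <= d%:E)%E.
Proof.
move=> d0 Ud; rewrite /diameter; case: asboolP => [_|_]; first by rewrite lee_fin.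
by apply: ge_ereal_sup => _ [[x y] [/= Ux Uy] <-]; rewrite lee_fin; exact: Ud.
Qed.

Lemma dist_le_diameter U x y : U x -> U y -> ((dist x y)%:E <= diameter dist U)%E.
Proof.
move=> Ux Uy; rewrite /diameter; case: asboolP => [U0|_].
  by move: Ux; rewrite U0.
by apply: le_ereal_sup_tmp; exists (dist x y)%:E => //; exists (x, y).
Qed.

Lemma diameter_pow_ge0 s U : (0 <= diameter_pow dist s U)%E.
Proof. by rewrite /diameter_pow; case: asboolP => // _; exact: poweR_ge0. Qed.

Lemma diameter_pow_le s U d : 0 <= s -> (diameter dist U <= d%:E)%E ->
  (diameter_pow dist s U <= (d `^ s)%:E)%E.
Proof.
move=> s0 Ud; rewrite /diameter_pow; case: asboolP => [_|_].
  by rewrite lee_fin powR_ge0.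
rewrite -poweR_EFin; apply: gt0_ler_poweR => //.
  by rewrite in_itv /= diameter_ge0 leey.
by rewrite in_itv /= leey andbT (le_trans (diameter_ge0 U)).
Qed.

(** Covers may be indexed by any countable type, such as finite words, and no mesh condition is
    asked for: a small total already makes each single term, hence each diameter, small. *)
Lemma hausdorff_measure_eq0 s A : 0 < s ->
  (forall e, 0 < e -> exists (I : countType) (V : I -> set T) (d : I -> R),
    [/\ A `<=` \bigcup_i V i, forall i, 0 <= d i,
        forall i x y, V i x -> V i y -> dist x y <= d i
      & forall r : seq I, uniq r -> \sum_(i <- r) d i `^ s <= e]) ->
  hausdorff_measure dist s A = 0%E.
Proof.
move=> s0 cov; apply/eqP; rewrite eq_le; apply/andP; split; last first.
  apply: le_ereal_sup_tmp; exists (hausdorff_premeasure dist s 1 A).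
    by exists 1 => //=.
  apply: le_ereal_inf_tmp => _ [U _ <-].
  by apply: nneseries_ge0 => i _ _; exact: diameter_pow_ge0.
apply: ge_ereal_sup => _ [delta /= delta0 <-].
apply/lee_addgt0Pr => e e0; rewrite add0e.
have e'0 : 0 < Num.min e (delta `^ s) by rewrite lt_min e0 powR_gt0.
have [I [V [d [AV d0 Vd ds]]]] := cov _ e'0.
(* Naturals that code no index receive the empty set, which contributes 0 to the sum. *)
pose U n := if pickle_inv n is Some i then V i else set0.
have dle i : d i <= delta.
  rewrite leNgt; apply/negP => ltd.
  have := ds [:: i] isT; rewrite big_seq1 le_min => /andP[_].
  by rewrite leNgt gt0_ltr_powR // ?nnegrE ?d0 // ltW.
apply: ge_ereal_inf; exists (\sum_(i <oo) diameter_pow dist s (U i))%E.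
  exists U => //; split=> [x /AV [i _ Vx]|n].
    by exists (pickle i) => //; rewrite /U pickleK_inv.
  rewrite /U; case: pickle_inv => [i|]; apply: diameter_le => //.
  - exact: ltW.
  - by move=> x y Vx Vy; exact: le_trans (Vd _ _ _ Vx Vy) (dle i).
  - exact: ltW.
apply: lime_le; first by apply: is_cvg_nneseries => n _ _; exact: diameter_pow_ge0.
apply: nearW => n; apply: (@le_trans _ _ (\sum_(i <- pmap (@pickle_inv I) (iota 0 n)) d i `^ s)%:E).
  rewrite -sumEFin big_pmap /index_iota subn0.
  apply: lee_sum => i _; rewrite /U; case: pickle_inv => [j|] /=.
    by apply: diameter_pow_le; [exact: ltW | apply: diameter_le => // x y; exact: Vd].
  by rewrite /diameter_pow; case: asboolP.
rewrite lee_fin (le_trans (ds _ _)) ?ge_min ?lexx //.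
by apply: (pmap_uniq (@pickle_invK I)); exact: iota_uniq.
Qed.

Lemma hausdorff_dim_sub A B : A `<=` B ->
  (hausdorff_dim dist A <= hausdorff_dim dist B)%E.
Proof.
move=> AB; apply: ereal_inf_le_tmp => _ [s [s0 Hs] <-]; exists s => //; split=> //.
apply/eqP; rewrite eq_le -{1}Hs; apply/andP; split.
  apply: ge_ereal_sup => _ [d d0 <-]; apply: le_ereal_sup_tmp.
  exists (hausdorff_premeasure dist s d B); first by exists d.
  by apply: ereal_inf_le_tmp => _ [U [BU Ud] <-]; exists U => //; split=> // x /AB; exact: BU.
apply: le_ereal_sup_tmp; exists (hausdorff_premeasure dist s 1 A); first by exists 1 => /=.
apply: le_ereal_inf_tmp => _ [U _ <-].
by apply: nneseries_ge0 => i _ _; exact: diameter_pow_ge0.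
Qed.

Lemma hausdorff_dim_le s0 A : 0 <= s0 ->
  (forall s, s0 < s -> hausdorff_measure dist s A = 0%E) ->
  (hausdorff_dim dist A <= s0%:E)%E.
Proof.
move=> s00 Hs; apply/lee_addgt0Pr => e e0.
apply: ge_ereal_inf; exists (s0 + e)%:E => //; exists (s0 + e) => //.
by split; [rewrite addr_ge0 // ltW | apply: Hs; rewrite ltrDl].
Qed.

Lemma sum_half_expr n : \sum_(i < n) (2^-1 : R) ^+ i.+1 <= 1.
Proof.
suff -> : \sum_(i < n) (2^-1 : R) ^+ i.+1 = 1 - 2^-1 ^+ n.
  by rewrite gerBl exprn_ge0 // invr_ge0.
elim: n => [|n IHn]; first by rewrite big_ord0 expr0 subrr.
by rewrite big_ord_recr /= IHn exprS; field.
Qed.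

(** If the measure of some exponent [r < s0] vanished, there would be covers by sets of diameter at
    most 1 with small [r]-sum. The midpoint [s] of [r] and [s0] is positive even when [r = 0], and
    the [s]-sum is no larger than the [r]-sum. *)
Lemma hausdorff_dim_ge s0 A :
  (forall s, 0 < s < s0 -> exists2 eta, 0 < eta &
    forall (U : nat -> set T) (d : nat -> R),
      A `<=` \bigcup_i U i -> (forall i, 0 < d i) ->
      (forall i x y, U i x -> U i y -> dist x y <= d i) ->
      (forall n, \sum_(i < n) d i `^ s <= eta) -> False) ->
  (s0%:E <= hausdorff_dim dist A)%E.
Proof.
move=> Hs; apply: le_ereal_inf_tmp => _ [r /= [r0 Hr] <-].
rewrite lee_fin leNgt; apply/negP => rs0.
pose s := (r + s0) / 2.
have rs : r < s by rewrite /s; lra.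
have s_gt0 : 0 < s by lra.
have [|eta eta0 noU] := Hs s; first by rewrite s_gt0 /s; lra.
have : (hausdorff_premeasure dist r 1 A < (eta / 2)%:E)%E.
  apply: (@le_lt_trans _ _ 0%E); last by rewrite lte_fin divr_gt0.
  by rewrite -Hr; apply: le_ereal_sup_tmp; exists (hausdorff_premeasure dist r 1 A) => //; exists 1 => /=.
case/ereal_inf_lt => _ [U [AU U1] <-] sumU.
pose D i := fine (diameter dist (U i)).
have DE i : diameter dist (U i) = (D i)%:E.
  rewrite /D fineK // ge0_fin_numE ?diameter_ge0 //.
  exact: le_lt_trans (U1 i) (ltry _).
have D0 i : 0 <= D i by rewrite -lee_fin -DE diameter_ge0.
have D1 i : D i <= 1 by rewrite -lee_fin -DE.
have Dr i : ((D i `^ s)%:E <= diameter_pow dist r (U i))%E.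
  rewrite /diameter_pow; case: asboolP => [Ui0|_].
    rewrite /D Ui0 /diameter; case: asboolP => //= _.
    by rewrite powR0 // gt_eqF.
  rewrite DE poweR_EFin lee_fin.
  have [->|Di0] := eqVneq (D i) 0; first by rewrite powR0 ?powR_ge0 // gt_eqF.
  by apply: ger_powR; rewrite ?D1 ?lt0r ?Di0 ?D0 // ltW.
pose e i := D i `^ s + eta / 2 * 2^-1 ^+ i.+1.
have e0 i : 0 < e i.
  by rewrite ltr_wpDl ?powR_ge0 // mulr_gt0 ?divr_gt0 ?exprn_gt0 ?invr_gt0.
have es i : (e i `^ s^-1) `^ s = e i.
  by rewrite -powRrM mulVf ?gt_eqF // powRr1 // ltW.
apply: (noU U (fun i => e i `^ s^-1)) => // [i|i x y Ux Uy|n].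
- exact: powR_gt0.
- apply: (@le_trans _ _ (D i)); first by rewrite -lee_fin -DE dist_le_diameter.
  have -> : D i = (D i `^ s) `^ s^-1 by rewrite -powRrM mulfV ?gt_eqF // powRr1.
  apply: ge0_ler_powR; rewrite ?invr_ge0 ?nnegrE ?powR_ge0 ?ltW //.
  by rewrite ltrDl mulr_gt0 ?divr_gt0 ?exprn_gt0 ?invr_gt0.
- under eq_bigr do rewrite es.
  rewrite big_split /= -mulr_sumr [leRHS](_ : _ = eta / 2 + eta / 2 * 1); last by field.
  apply: lerD; last by rewrite ler_wpM2l ?sum_half_expr // divr_ge0 // ltW.
  rewrite -lee_fin; apply: le_trans (ltW sumU).
  apply: (@le_trans _ _ (\sum_(0 <= i < n) diameter_pow dist r (U i))%E).
    by rewrite -sumEFin big_mkord; apply: lee_sum => i _; exact: Dr.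
  by apply: nneseries_lim_ge => i _ _; exact: diameter_pow_ge0.
Qed.

End HausdorffBounds.

(** * Words whose alphabet depends on the position *)

Section Words.
Context {A : eqType}.
Implicit Types (D : nat -> seq A) (w : seq A) (x : nat -> A).

Fixpoint words D n : seq (seq A) :=
  if n is m.+1 then [seq rcons w a | w <- words D m, a <- D m] else [:: [::]].

Lemma uniq_words D n : (forall k, uniq (D k)) -> uniq (words D n).
Proof.
move=> uD; elim: n => //= n IHn; apply: allpairs_uniq => //.
by move=> [u a] [v b] _ _ /= /rcons_inj [-> ->].
Qed.

Lemma mkseq_words D n x : (forall k, (k < n)%N -> x k \in D k) -> mkseq x n \in words D n.
Proof.
elim: n => [|n IHn] Dx //=; rewrite mkseqS; apply: allpairs_f; last exact: Dx.
by apply: IHn => k kn; apply: Dx; exact: ltnW.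
Qed.

Lemma const_words (s : seq A) w : {subset w <= s} -> w \in words (fun=> s) (size w).
Proof.
case: w => // a w sw; rewrite -{1}(mkseq_nth a (a :: w)).
by apply: mkseq_words => k kw; apply: sw; exact: mem_nth.
Qed.

Lemma sum_prod_words (R : comPzRingType) D n (g : A -> R) :
  \sum_(w <- words D n) \prod_(a <- w) g a = \prod_(k < n) \sum_(a <- D k) g a.
Proof.
elim: n => [|n IHn] /=; first by rewrite big_seq1 big_nil big_ord0.
rewrite big_ord_recr /= -IHn big_allpairs_dep big_distrl /=.
apply: eq_bigr => w _; rewrite mulr_sumr.
by apply: eq_bigr => a _; rewrite -cats1 big_cat big_seq1.
Qed.

End Words.

(** * Uniform bounds for sums over words and over pairs of integers *)

Section FiniteSums.
Context {R : realType}.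

Lemma ler_sum_subset (A : eqType) (s t : seq A) (F : A -> R) :
  uniq s -> {subset s <= t} -> (forall i, 0 <= F i) ->
  \sum_(i <- s) F i <= \sum_(i <- t) F i.
Proof.
move=> us st F0; elim: s t us st => [|a s IHs] t /=.
  by move=> _ _; rewrite big_nil sumr_ge0.
case/andP => nas us st; have ta : a \in t by apply: st; rewrite mem_head.
rewrite (perm_big _ (perm_to_rem ta)) !big_cons lerD2l; apply: IHs => // i si.
have := st i; rewrite inE si orbT => /(_ isT).
rewrite (perm_mem (perm_to_rem ta)) inE => /orP[/eqP ia|//].
by move: nas; rewrite -ia si.
Qed.

(** The finitely many words use a finite alphabet [L]. The sum over all words of length [n] in [L]
    factors as the [n]-th power of the sum over [L]. *)
Lemma sum_prod_size_le (A : eqType) (g : A -> R) q n (r : seq (seq A)) :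
  (forall a, 0 <= g a) -> (forall s, uniq s -> \sum_(a <- s) g a <= q) ->
  uniq r -> (forall w, w \in r -> size w = n) ->
  \sum_(w <- r) \prod_(a <- w) g a <= q ^+ n.
Proof.
move=> g0 gq ur rn; pose L := undup (flatten r).
apply: (@le_trans _ _ (\sum_(w <- words (fun=> L) n) \prod_(a <- w) g a)).
  apply: ler_sum_subset => // [w rw|w]; last by apply: prodr_ge0 => a _.
  rewrite -(rn _ rw); apply: const_words => a wa.
  by rewrite mem_undup; apply/flattenP; exists w.
rewrite sum_prod_words prodr_const card_ord.
have L0 : 0 <= \sum_(a <- L) g a by apply: sumr_ge0.
have Lq : \sum_(a <- L) g a <= q by apply: gq; exact: undup_uniq.
by apply: lerXn2r; rewrite ?nnegrE // (le_trans L0).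
Qed.

(** Grouping the words by length [n] bounds the sum by the geometric tail of the [2^-n] with
    [n >= N]. *)
Lemma sum_prod_tail_le (A : eqType) (g : A -> R) N (r : seq (seq A)) :
  (forall a, 0 <= g a) -> (forall s, uniq s -> \sum_(a <- s) g a <= 2^-1) ->
  uniq r -> (forall w, w \in r -> (N <= size w)%N) ->
  \sum_(w <- r) \prod_(a <- w) g a <= 2 * 2^-1 ^+ N.
Proof.
move=> g0 gq ur rN; pose M := (\max_(w <- r) size w).+1.
have rM w : w \in r -> (size w < M)%N.
  by move=> rw; rewrite ltnS; exact: leq_bigmax_seq.
have -> : \sum_(w <- r) \prod_(a <- w) g a =
    \sum_(N <= n < M) \sum_(w <- r | n == size w) \prod_(a <- w) g a.
  rewrite (exchange_big_dep xpredT) //= [LHS]big_seq [RHS]big_seq.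
  by apply: eq_bigr => w rw; rewrite big_nat1_eq /= rN // rM.
apply: (@le_trans _ _ (\sum_(N <= n < M) 2^-1 ^+ n)).
  apply: ler_sum => n _; rewrite -big_filter; apply: sum_prod_size_le => //.
    exact: filter_uniq.
  by move=> w; rewrite mem_filter => /andP[/eqP ->].
have [MN|NM] := leqP M N; first by rewrite big_geq // mulr_ge0 ?exprn_ge0 ?invr_ge0.
suff -> : \sum_(N <= n < M) 2^-1 ^+ n = 2 * 2^-1 ^+ N - 2 * 2^-1 ^+ M :> R.
  by rewrite gerBl mulr_ge0 ?exprn_ge0 ?invr_ge0.
rewrite -(subnKC (ltnW NM)); elim: (M - N)%N => [|k IHk].
  by rewrite addn0 big_geq // subrr.
by rewrite addnS big_nat_recr ?leq_addr //= IHk exprS; field.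
Qed.

Lemma powRN_diff_ge (q x : R) : 0 < q -> 0 < x ->
  q * (x + 1) `^ (- (q + 1)) <= x `^ (- q) - (x + 1) `^ (- q).
Proof.
move=> q0 x0; have x10 : 0 < x + 1 by rewrite addr_gt0.
have -> : x `^ (- q) = (x + 1) `^ (- q) * expR (q * (ln (x + 1) - ln x)).
  by rewrite /powR !gt_eqF // -expRD; congr expR; ring.
have -> : (x + 1) `^ (- (q + 1)) = (x + 1) `^ (- q) * (x + 1)^-1.
  by rewrite opprD powRD ?(gt_eqF x10) ?implybT // (powR_inv1 (ltW x10)).
rewrite mulrCA -[X in _ - X]mulr1 -mulrBr ler_wpM2l ?powR_ge0 //.
rewrite lerBrDl; apply: le_trans (expR_ge1Dx _); rewrite lerD2l ler_wpM2l ?(ltW q0) //.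
rewrite -lerN2 opprB -ln_div ?posrE //.
have -> : x / (x + 1) = 1 + - (x + 1)^-1 by field; rewrite gt_eqF.
by apply: le_ln1Dx; rewrite ltrN2 invf_lt1 // ltrDr.
Qed.

Lemma sum_powRN_le (p : R) : 1 < p ->
  exists Z, forall n, \sum_(k < n) k.+1%:R `^ (- p) <= Z.
Proof.
move=> p1; pose q := p - 1; have q0 : 0 < q by rewrite subr_gt0.
exists (1 + q^-1) => -[|n]; first by rewrite big_ord0 addr_ge0 // invr_ge0 ltW.
(* The sharper bound with its negative term is what the induction can carry. *)
apply: (@le_trans _ _ (1 + (1 - n.+1%:R `^ (- q)) / q)); last first.
  by rewrite lerD2l ler_pdivrMr // mulVf ?gt_eqF // gerBl powR_ge0.
elim: n => [|n IHn]; first by rewrite big_ord1 !powR1 subrr mul0r addr0.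
rewrite big_ord_recr /=.
apply: (@le_trans _ _ (1 + (1 - n.+1%:R `^ (- q)) / q + n.+2%:R `^ (- p))).
  by rewrite lerD2r.
have := @powRN_diff_ge q n.+1%:R q0 (ltr0Sn _ _).
rewrite -natr1 [q + 1](_ : _ = p) ?subrK // => /(ler_wpM2l (ltW (_ : 0 < q^-1))).
rewrite invr_gt0 => /(_ q0); rewrite mulKf ?gt_eqF // mulrBr => H.
rewrite -addrA lerD2l -[n.+2%:R]natr1 -[n.+1%:R]natr1; move: H; rewrite !mulrBl ![_ * q^-1]mulrC; lra.
Qed.

(* The digit 0 contributes nothing, since 0 `^ (- t) = 0. *)
Lemma sum_int2_powRN_le (t : R) : 2 < t ->
  exists Z, forall r : seq (int * int), uniq r ->
    \sum_(a <- r) (Num.max `|a.1%:~R| `|a.2%:~R| : R) `^ (- t) <= Z.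
Proof.
move=> t2; have [Z HZ] : exists Z, forall n, \sum_(k < n) k.+1%:R `^ (- (t / 2)) <= Z.
  by apply: sum_powRN_le; rewrite ltr_pdivlMr // mul1r.
have tN0 : - t != 0 by rewrite oppr_eq0 gt_eqF // (lt_trans _ t2).
pose h (x : int) : R := (`|x|%:~R + 1) `^ (- (t / 2)).
have h0 x : 0 <= h x by exact: powR_ge0.
have hbox M : \sum_(x <- [seq Posz k | k <- iota 0 M] ++ [seq Negz k | k <- iota 0 M]) h x
    <= Z + Z.
  rewrite big_cat !big_map /=; apply: lerD; apply: le_trans (HZ M);
    rewrite -{1}[M]subn0 -/(index_iota 0 M) big_mkord; apply: ler_sum => k _.
    by rewrite /h /= natr1.
  rewrite /h /= !powRN lef_pV2 ?posrE ?powR_gt0 ?ltr0Sn ?addr_gt0 //.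
  rewrite ge0_ler_powR ?nnegrE ?addr_ge0 // ?ltW ?divr_gt0 // ?(lt_trans _ t2) //.
  by rewrite ltr_pwDr.
have le_h (a : int * int) : (Num.max `|a.1%:~R| `|a.2%:~R| : R) `^ (- t) <= 2 `^ t * (h a.1 * h a.2).
  case: a => x y /=; set m : R := Num.max _ _.
  have m0 : 0 <= m by rewrite le_max normr_ge0.
  have [->|mN0] := eqVneq m 0; first by rewrite powR0 // mulr_ge0 ?powR_ge0 ?mulr_ge0.
  have m1 : 1 <= m.
    have [x0|x0] := eqVneq x 0; last by rewrite le_max -intr_norm ler1z -gtz0_ge1 normr_gt0 x0.
    have [y0|y0] := eqVneq y 0; last by rewrite le_max -!intr_norm !ler1z -!gtz0_ge1 !normr_gt0 y0 orbT.
    by move: mN0; rewrite /m x0 y0 normr0 maxxx eqxx.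
  have hm (z : int) : `|z%:~R| <= m -> (2 * m) `^ (- (t / 2)) <= h z.
    move=> zm; have z0 : 0 < `|z|%:~R + 1 :> R by rewrite ltr_wpDl // ler0z.
    have z2 : `|z|%:~R + 1 <= 2 * m by rewrite intr_norm mulr_natl mulr2n lerD.
    rewrite /h !powRN lef_pV2 ?posrE ?powR_gt0 ?(lt_le_trans z0) //.
    apply: ge0_ler_powR z2; rewrite ?nnegrE ?(ltW z0) ?(le_trans (ltW z0) z2) //.
      by rewrite divr_ge0 // ltW // (lt_trans _ t2).
    exact: mulr_ge0.
  have -> : m `^ (- t) = 2 `^ t * ((2 * m) `^ (- (t / 2)) * (2 * m) `^ (- (t / 2))).
    have m2 : 2 * m != 0 by rewrite mulf_neq0 // pnatr_eq0.
    rewrite -powRD ?m2 ?implybT //.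
    have -> : - (t / 2) + - (t / 2) = - t by field.
    rewrite powRM // mulrA -powRD ?pnatr_eq0 ?implybT //.
    by rewrite subrr powRr0 mul1r.
  rewrite ler_wpM2l ?powR_ge0 //; apply: ler_pM; rewrite ?powR_ge0 ?hm //.
    by rewrite le_max lexx.
  by rewrite le_max lexx orbT.
exists (2 `^ t * ((Z + Z) * (Z + Z))) => r ur.
pose M := (\max_(a <- r) maxn `|a.1| `|a.2|).+1.
pose B := [seq Posz k | k <- iota 0 M] ++ [seq Negz k | k <- iota 0 M].
have inB (x : int) : (`|x| < M)%N -> x \in B.
  rewrite mem_cat; case: x => k kM; apply/orP; [left|right]; apply/mapP; exists k => //.
    by rewrite mem_iota.
  by rewrite mem_iota; exact: ltnW.
apply: (@le_trans _ _ (\sum_(a <- r) 2 `^ t * (h a.1 * h a.2))); first by apply: ler_sum => a _.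
rewrite -mulr_sumr ler_wpM2l ?powR_ge0 //.
apply: (@le_trans _ _ (\sum_(a <- [seq (x, y) | x <- B, y <- B]) (h a.1 * h a.2))).
  apply: ler_sum_subset => // [[x y] ra|a]; last exact: mulr_ge0.
  have : (maxn `|x| `|y| < M)%N.
    by rewrite ltnS (bigD1_seq _ ra) ?ur //= leq_maxl.
  by rewrite gtn_max => /andP[xM yM]; apply: allpairs_f; exact: inB.
rewrite big_allpairs_dep /=; under eq_bigr do rewrite -mulr_sumr.
rewrite -mulr_suml; apply: ler_pM; rewrite ?sumr_ge0 ?hbox //.
Qed.

End FiniteSums.

(** * One step of the Gauss map and diameters of cylinders *)

Section GaussMap.
Context {R : realType}.
Local Notation C := (R[i]).
Local Notation normc := Normc.normc.
Implicit Types (z w : C) (a : int * int).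

Definition gint a : C := Complex a.1%:~R a.2%:~R.

(** A partial quotient is coded by a pair of integers, so that digit words form a countable type. *)
Definition digit z : int * int :=
  (Num.floor (complex.Re z^-1 + 2^-1), Num.floor (complex.Im z^-1 + 2^-1)).

Definition int2_norm a : R := Num.max `|a.1%:~R| `|a.2%:~R|.

(** Indices start at 0: this encodes $a_{n+1}(z)$. *)
Definition orbit_digit z n : int * int := digit (iter n gauss_map z).

Lemma normc_ge0 z : 0 <= normc z.
Proof. by case: z => x y; exact: sqrtr_ge0. Qed.

Lemma sqr_normc z : normc z ^+ 2 = complex.Re z ^+ 2 + complex.Im z ^+ 2.
Proof. by case: z => x y /=; rewrite sqr_sqrtr // addr_ge0 ?sqr_ge0. Qed.

Lemma normc_gt0 z : z != 0 -> 0 < normc z.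
Proof.
move=> z0; rewrite lt0r normc_ge0 andbT; apply: contra z0 => /eqP h.
by rewrite (Normc.eq0_normc h).
Qed.

Lemma Re_le_normc z : `|complex.Re z| <= normc z.
Proof.
rewrite -(@ler_pXn2r _ 2%N) ?nnegrE ?normc_ge0 ?normr_ge0 // sqr_normc real_normK ?num_real //.
by rewrite lerDl sqr_ge0.
Qed.

Lemma Im_le_normc z : `|complex.Im z| <= normc z.
Proof.
rewrite -(@ler_pXn2r _ 2%N) ?nnegrE ?normc_ge0 ?normr_ge0 // sqr_normc real_normK ?num_real //.
by rewrite lerDr sqr_ge0.
Qed.

Lemma normc_le_ReIm z : normc z <= `|complex.Re z| + `|complex.Im z|.
Proof.
rewrite -(@ler_pXn2r _ 2%N) ?nnegrE ?normc_ge0 ?addr_ge0 ?normr_ge0 // sqr_normc.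
rewrite sqrrD !real_normK ?num_real // addrAC lerDl.
by rewrite pmulrn_lge0 // mulr_ge0.
Qed.

Lemma normcB z w : normc (z - w) = normc (w - z).
Proof.
by case: z w => [x y] [x' y'] /=; rewrite -[x - _]opprB -[y - _]opprB !sqrrN.
Qed.

Lemma cdist_ge0 z w : 0 <= cdist z w.
Proof. exact: normc_ge0. Qed.

Lemma hurwitz_domainP z : hurwitz_domain z <->
  (- 2^-1 <= complex.Re z < 2^-1) && (- 2^-1 <= complex.Im z < 2^-1).
Proof.
have floor0P (x : R) : (Num.floor (x + 2^-1))%:~R = 0 :> R <-> - 2^-1 <= x < 2^-1.
  have -> : (- 2^-1 <= x < 2^-1) = (Num.floor (x + 2^-1) == 0).
    rewrite floor_eq add0r mulr0z mulr1z -[in RHS]lerBlDr sub0r -ltrBrDr.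
    by rewrite [1 - _](_ : _ = 2^-1) //; field.
  by split=> [/eqP|/eqP -> //]; rewrite intr_eq0.
case: z => x y; rewrite /hurwitz_domain /near_gint /=; split=> [[/floor0P -> /floor0P ->] //|].
by case/andP => /floor0P -> /floor0P ->.
Qed.

Lemma hurwitz_domain_lt1 z : hurwitz_domain z -> normc z < 1.
Proof.
case/hurwitz_domainP/andP => /andP[x1 x2] /andP[y1 y2].
rewrite -(@ltr_pXn2r _ 2%N) ?nnegrE ?normc_ge0 // expr1n sqr_normc.
have sq (x : R) : - 2^-1 <= x -> x < 2^-1 -> x ^+ 2 <= 4^-1 by nra.
by apply: le_lt_trans (lerD (sq _ x1 x2) (sq _ y1 y2)) _; lra.
Qed.

Lemma hurwitz_domain_gauss z : hurwitz_domain (gauss_map z).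
Proof.
apply/hurwitz_domainP; rewrite /gauss_map; case: eqP => _.
  by rewrite /= oppr_le0 invr_ge0 invr_gt0 ler0n ltr0n.
rewrite /near_gint; case: (z^-1) => x y /=.
have fr (t : R) : - 2^-1 <= t - (Num.floor (t + 2^-1))%:~R < 2^-1.
  have := floor_itv (t + 2^-1); rewrite intrD.
  by move: (Num.floor _)%:~R => f; rewrite [1%:~R]/=; lra.
by rewrite !fr.
Qed.

Lemma hurwitz_domain_iter z n : hurwitz_domain z -> hurwitz_domain (iter n gauss_map z).
Proof. by case: n => //= n _; exact: hurwitz_domain_gauss. Qed.

Lemma gauss_mapE z : z != 0 -> gauss_map z = z^-1 - gint (digit z).
Proof. by rewrite /gauss_map => /negbTE ->. Qed.

Lemma int2_norm_ge0 a : 0 <= int2_norm a.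
Proof. by rewrite le_max normr_ge0. Qed.

Lemma int2_norm_ge1 a : a != (0, 0) -> 1 <= int2_norm a.
Proof.
case: a => x y; rewrite xpair_eqE negb_and /int2_norm le_max /= -!intr_norm !ler1z -!gtz0_ge1 !normr_gt0.
by case/orP => ->; rewrite ?orbT.
Qed.

(** If the digit were 0, then [z^-1] would equal [gauss_map z] and have modulus below 1, although
    [z] has modulus below 1 too. *)
Lemma digit_ge1 z : hurwitz_domain z -> z != 0 -> 1 <= int2_norm (digit z).
Proof.
move=> Dz z0; apply: int2_norm_ge1; apply/eqP => d0.
have := hurwitz_domain_gauss z; rewrite gauss_mapE // d0.
rewrite [gint _](_ : _ = 0) ?subr0 // => /hurwitz_domain_lt1.
rewrite Normc.normcV => /ltW; rewrite invf_le1 ?normc_gt0 // leNgt.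
by rewrite hurwitz_domain_lt1.
Qed.

(** The digit differs from [z^-1] by at most 1/2 in each coordinate, and this error is absorbed
    because [z^-1] has modulus above 1. *)
Lemma normc_digit_le z : hurwitz_domain z -> z != 0 -> normc z <= 2 / int2_norm (digit z).
Proof.
move=> Dz z0; have n0 := normc_gt0 z0; have n1 := hurwitz_domain_lt1 Dz.
have d1 := digit_ge1 Dz z0.
rewrite ler_pdivlMr ?(lt_le_trans ltr01) // mulrC -ler_pdivlMr //.
have V1 : 1 < (normc z)^-1 by rewrite invf_gt1.
have := hurwitz_domain_gauss z; rewrite gauss_mapE // => /hurwitz_domainP.
have := Re_le_normc z^-1; have := Im_le_normc z^-1; rewrite Normc.normcV.
rewrite /int2_norm ge_max; move: V1; set v := (normc z)^-1.
move: (digit z) => [p q] /=; case: (z^-1) => x y /=.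
rewrite !ler_norml; move: (p%:~R : R) (q%:~R : R) => P Q; lra.
Qed.

Lemma normc_gauss z w : z != 0 -> w != 0 -> digit z = digit w ->
  normc (z - w) = normc z * normc w * normc (gauss_map z - gauss_map w).
Proof.
move=> z0 w0 dzw; rewrite -!Normc.normcM !gauss_mapE // dzw normcB.
by congr normc; field; rewrite z0 w0.
Qed.

Lemma normc_cylinder_le z w n : hurwitz_domain z -> hurwitz_domain w ->
  (forall k, (k < n)%N ->
     [/\ iter k gauss_map z != 0, iter k gauss_map w != 0 & orbit_digit z k = orbit_digit w k]) ->
  normc (z - w) <= (\prod_(k < n) (4 / int2_norm (orbit_digit z k) ^+ 2)) *
                   normc (iter n gauss_map z - iter n gauss_map w).
Proof.
move=> Dz Dw; elim: n => [|n IHn] H; first by rewrite big_ord0 mul1r.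
apply: le_trans (IHn _) _ => [k kn|]; first exact/H/ltnW.
have [zn wn dn] := H n (ltnSn n).
rewrite big_ord_recr /= -mulrA ler_wpM2l //.
  by apply: prodr_ge0 => k _; rewrite divr_ge0 ?exprn_ge0 ?int2_norm_ge0.
rewrite normc_gauss // ler_wpM2r ?normc_ge0 //.
have Dzn := hurwitz_domain_iter n Dz; have Dwn := hurwitz_domain_iter n Dw.
have -> : 4 / int2_norm (orbit_digit z n) ^+ 2 =
  (2 / int2_norm (orbit_digit z n)) * (2 / int2_norm (orbit_digit w n)).
  by rewrite -dn; field; rewrite gt_eqF // (lt_le_trans ltr01) ?digit_ge1.
by apply: ler_pM; rewrite ?normc_ge0 ?normc_digit_le.
Qed.

End GaussMap.

(** * Growth of sequences and an interpolation inequality *)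

Section Growth.
Context {R : realType}.

Lemma bernoulli_le (x : R) n : 0 <= x -> 1 + n%:R * x <= (1 + x) ^+ n.
Proof.
move=> x0; elim: n => [|n IHn]; first by rewrite mul0r addr0 expr0.
rewrite exprS; apply: le_trans (ler_wpM2l _ IHn); last by rewrite addr_ge0.
rewrite -natr1; have : 0 <= n%:R * (x * x) by rewrite !mulr_ge0.
by rewrite mulrDl; lra.
Qed.

Lemma natr_le_expr (x : R) n : 1 <= x -> n%:R * (x - 1) <= x ^+ n.
Proof.
move=> x1; have := @bernoulli_le (x - 1) n; rewrite subr_ge0 subrKC => /(_ x1).
by apply: le_trans; rewrite lerDr.
Qed.

(** Since the powers of [Num.sqrt b] grow at least linearly, [b ^+ n] dominates a multiple of
    [n ^ 2]. The constant [B] comes from completing the square. *)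
Lemma linear_le_expr (A k b : R) : 0 < k -> 1 < b ->
  exists B, forall n, A * n%:R <= k * b ^+ n + B.
Proof.
move=> k0 b1; pose r := Num.sqrt b; have b0 : 0 <= b by rewrite ltW // (lt_trans ltr01).
have r1 : 1 < r by rewrite -sqrtr1 ltr_sqrt // (lt_trans ltr01).
pose e := r - 1; have e0 : 0 < e by rewrite subr_gt0.
exists (A ^+ 2 / (4 * k * e ^+ 2)) => n.
have rn : (n%:R * e) ^+ 2 <= b ^+ n.
  rewrite -(sqr_sqrtr b0) -exprM mulnC exprM lerXn2r ?nnegrE ?mulr_ge0 ?exprn_ge0 ?sqrtr_ge0 ?(ltW e0) //.
  by apply: natr_le_expr; exact: ltW.
apply: le_trans (lerD (ler_wpM2l (ltW k0) rn) (lexx _)); rewrite -subr_ge0.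
have -> : k * (n%:R * e) ^+ 2 + A ^+ 2 / (4 * k * e ^+ 2) - A * n%:R =
    k * (n%:R * e - A / (2 * k * e)) ^+ 2.
  by field; rewrite !gt_eqF.
by rewrite mulr_ge0 ?sqr_ge0 // ltW.
Qed.

Lemma sum_expr_ge (b : R) n : 1 < b -> (b ^+ n.+1 - b) / (b - 1) <= \sum_(k < n) b ^+ k.+1.
Proof.
move=> b1; rewrite le_eqVlt; apply/orP; left; apply/eqP.
have b10 : b - 1 != 0 by rewrite gt_eqF // subr_gt0.
elim: n => [|n IHn]; first by rewrite big_ord0 expr1 subrr mul0r.
by rewrite big_ord_recr /= -IHn !exprS; field.
Qed.

Lemma infinite_nat_ge (S : set nat) M : infinite_set S -> exists2 n, S n & (M <= n)%N.
Proof.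
move=> Sinf; apply: contrapT => noS; apply: Sinf; apply: sub_finite_set (finite_II M) => n Sn /=.
by rewrite ltnNge; apply/negP => Mn; apply: noS; exists n.
Qed.

(* Otherwise the partial sums would satisfy L (n + 1) <= b' L n + h n eventually,
   hence be O(beta ^ n) for every beta > b'. *)
Lemma sum_jump_io (u : nat -> R) (b b' l h : R) N :
  1 < b' -> b' < b -> 0 < l -> (forall k, 0 <= u k) ->
  infinite_set [set n | (1 <= n)%N /\ b ^+ n * l <= u n.-1] ->
  exists2 n, (N <= n)%N & (b' - 1) * (\sum_(k < n) u k) + h * n%:R <= u n.
Proof.
move=> b'1 b'b l0 u0 io; apply: contrapT => noj.
pose L n := \sum_(k < n) u k.
(* The margin between [b'] and [beta] absorbs the linear term; the margin between [beta] and [b]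
   gives the contradiction. *)
pose beta := (b' + b) / 2; have b1 : b' < beta by rewrite /beta; lra.
have b2 : beta < b by rewrite /beta; lra.
have step n : (N <= n)%N -> L n.+1 <= b' * L n + h * n%:R.
  move=> Nn; have un : u n < (b' - 1) * L n + h * n%:R.
    by rewrite ltNge; apply/negP => un; apply: noj; exists n.
  by rewrite /L big_ord_recr /= -/(L n); lra.
have L0 n : 0 <= L n by apply: sumr_ge0.
(* [K] dominates [L N] for the base case, and satisfies [K * (beta - b') * (beta - 1) >= |h|], so
   that the term [h * n] is swallowed by [beta ^+ n >= n * (beta - 1)]. *)
pose K := L N + `|h| / ((beta - b') * (beta - 1)).
have d0 : 0 < (beta - b') * (beta - 1) by rewrite mulr_gt0 // subr_gt0 // (lt_trans b'1).
have K0 : 0 <= K by rewrite addr_ge0 // divr_ge0 // ltW.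
have beta1 : 1 <= beta by rewrite ltW // (lt_trans b'1).
have LK n : (N <= n)%N -> L n <= K * beta ^+ n.
  move=> Nn; rewrite -(subnKC Nn); elim: (n - N)%N => [|m IHm].
    rewrite addn0; apply: (@le_trans _ _ K); first by rewrite lerDl divr_ge0 // ltW.
    by rewrite ler_peMr // exprn_ege1.
  rewrite addnS; apply: le_trans (step _ (leq_addr _ _)) _.
  apply: le_trans (lerD (ler_wpM2l (ltW (lt_trans ltr01 b'1)) IHm) (lexx _)) _.
  set M := (N + m)%N; rewrite exprS -subr_ge0.
  have -> : K * (beta * beta ^+ M) - (b' * (K * beta ^+ M) + h * M%:R) =
    K * (beta - b') * beta ^+ M - h * M%:R by ring.
  rewrite subr_ge0; apply: (@le_trans _ _ (K * (beta - b') * (M%:R * (beta - 1)))); last first.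
    rewrite ler_wpM2l ?natr_le_expr // mulr_ge0 // subr_ge0 ltW //.
  rewrite [leRHS](_ : _ = K * ((beta - b') * (beta - 1)) * M%:R) ?ler_wpM2r //; last by ring.
  rewrite /K mulrDl mulfVK ?gt_eqF //; apply: (le_trans (ler_norm h)).
  by rewrite lerDr mulr_ge0 // ltW.
pose r := b / beta; have beta0 : 0 < beta by rewrite (lt_le_trans ltr01).
have r1 : 1 < r by rewrite /r ltr_pdivlMr // mul1r.
(* From this index on, [r ^+ n * l] exceeds [K]. *)
pose m := (Num.truncn (K / (l * (r - 1)))).+1.
have [n [n1 un] Mn] := infinite_nat_ge (N + m)%N io.
have : b ^+ n * l <= K * beta ^+ n.
  apply: le_trans un _; apply: le_trans (LK _ (leq_trans (leq_addr _ _) Mn)).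
  rewrite /L; case: n n1 {Mn} => // n _; rewrite big_ord_recr /= lerDr.
  by apply: sumr_ge0.
have -> : b = r * beta by rewrite /r divfK // gt_eqF.
rewrite exprMn mulrAC ler_pM2r ?exprn_gt0 //; apply/negP; rewrite -ltNge.
apply: lt_le_trans (ler_wpM2r (ltW l0) (natr_le_expr n (ltW r1))).
rewrite -mulrA [_ * l]mulrC -ltr_pdivrMr ?mulr_gt0 ?subr_gt0 //.
apply: (lt_le_trans (truncnS_gt _)).
by rewrite ler_nat; apply: leq_trans Mn; rewrite leq_addl.
Qed.

(** Write [x] as the product of its powers of exponents [(2 - s) / 2] and [s / 2], and bound each
    factor by one of the two hypotheses. *)
Lemma sqr_min_interpolation (x a b s : R) : 0 <= x -> 0 <= a -> 0 <= b -> 0 < s < 2 ->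
  x <= a ^+ 2 -> x <= b ^+ 2 -> x <= a `^ (2 - s) * b `^ s.
Proof.
move=> x0 a0 b0 /andP[s0 s2] xa xb.
have [->|xN0] := eqVneq x 0; first by rewrite mulr_ge0 ?powR_ge0.
have pw (c e : R) : 0 <= c -> 0 < e -> x <= c ^+ 2 -> x `^ (e / 2) <= c `^ e.
  move=> c0 e0 xc; have -> : c `^ e = (c ^+ 2) `^ (e / 2).
    by rewrite -powR_mulrn // -powRrM mulrCA mulfV ?mulr1 // pnatr_eq0.
  by apply: ge0_ler_powR; rewrite ?nnegrE ?exprn_ge0 // divr_ge0 // ltW.
have {1}-> : x = x `^ ((2 - s) / 2) * x `^ (s / 2).
  rewrite -powRD ?xN0 ?implybT //.
  by rewrite [X in x `^ X](_ : _ = 1) ?powRr1 //; field.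
by apply: ler_pM; rewrite ?powR_ge0 // pw // subr_gt0.
Qed.

End Growth.

(** * Upper bound: covering [Xi_io] by shortened cylinders *)

Section UpperBound.
Context {R : realType}.
Local Notation C := (R[i]).
Local Notation normc := Normc.normc.
Implicit Types (z : C) (w : seq (int * int)).

Lemma iter_gauss0 n : iter n gauss_map (0 : C) = 0.
Proof. by elim: n => //= n ->; rewrite /gauss_map eqxx. Qed.

(** An orbit that reaches 0 stays there, so infinitely many defined quotients exclude every zero
    iterate. *)
Lemma Xi_io_digits (b c : R) z : Xi_io b c z ->
  [/\ hurwitz_domain z, forall k, iter k gauss_map z != 0
    & infinite_set [set n | (1 <= n)%N /\ c `^ (b ^+ n) <= int2_norm (orbit_digit z n.-1)]].
Proof.
case=> Dz io; split=> // [k|].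
  have [n [n1 [+ _]] kn] := infinite_nat_ge k.+1 io.
  apply: contra => /eqP zk; rewrite /pquot_defined.
  by rewrite -(subnK (_ : (k <= n.-1)%N)) ?iterD ?zk ?iter_gauss0 // -ltnS prednK.
apply: contra_not io; apply: sub_finite_set => n [n1 [_ Hn]]; split=> //.
Qed.

(* [cyl_tail kappa b' w] is the reciprocal of the lower bound imposed on the digit
   that follows the prefix w. *)
Definition cyl_tail (kappa b' : R) w : R :=
  \prod_(a <- w) (kappa / 4 * int2_norm a `^ (- (b' - 1))).

(** The covering sets, one for each word: the part of the cylinder of [w] where the next digit is
    exceptionally large. The bound [N] on the length makes the total of the diameters small. *)
Definition jump_cyl (kappa b' : R) N w : set C :=
  [set z | [/\ hurwitz_domain z, forall k, iter k gauss_map z != 0,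
    w = mkseq (orbit_digit z) (size w), (N <= size w)%N
    & 1 <= cyl_tail kappa b' w * int2_norm (orbit_digit z (size w))]].

(** After the prefix both iterates have modulus at most [2 * cyl_tail kappa b' w], by the large next
    digit. Each factor of [cyl_tail] then combines with the factor [4 / int2_norm a ^+ 2] from
    [normc_cylinder_le]: the 4 cancels and the exponents add up to [- (b' + 1)]. *)
Lemma jump_cyl_diam kappa b' N w z z' : 0 < kappa ->
  jump_cyl kappa b' N w z -> jump_cyl kappa b' N w z' ->
  normc (z - z') <= 4 * \prod_(a <- w) (kappa * int2_norm a `^ (- (b' + 1))).
Proof.
move=> k0 [Dz z0 wz _ tz] [Dz' z0' wz' _ tz']; set n := size w in wz wz' tz tz'.
have digE k : (k < n)%N -> orbit_digit z k = orbit_digit z' k.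
  by move=> kn; have := congr1 (nth (0, 0) ^~ k) wz; rewrite wz' !nth_mkseq.
apply: le_trans (@normc_cylinder_le _ z z' n Dz Dz' _) _ => [k kn|]; first by split=> //; exact: digE.
have tail y : hurwitz_domain y -> (forall k, iter k gauss_map y != 0) ->
    1 <= cyl_tail kappa b' w * int2_norm (orbit_digit y n) ->
    normc (iter n gauss_map y) <= 2 * cyl_tail kappa b' w.
  move=> Dy y0 ty; have Dyn := hurwitz_domain_iter n Dy.
  apply: le_trans (normc_digit_le Dyn (y0 n)) _.
  by rewrite ler_pdivrMr ?(lt_le_trans ltr01 (digit_ge1 Dyn (y0 n))) // -mulrA ler_peMr.
apply: (@le_trans _ _ ((\prod_(k < n) (4 / int2_norm (orbit_digit z k) ^+ 2)) *
    (4 * cyl_tail kappa b' w))).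
  rewrite ler_wpM2l //.
    by apply: prodr_ge0 => k _; rewrite divr_ge0 ?exprn_ge0 ?int2_norm_ge0.
  apply: le_trans (complex.le_normcD _ _) _; rewrite complex.normcN.
  by apply: le_trans (lerD (tail _ Dz z0 tz) (tail _ Dz' z0' tz')) _; rewrite -mulrDl; lra.
rewrite mulrCA ler_wpM2l // /cyl_tail wz !big_map.
rewrite (_ : iota 0 n = index_iota 0 n) ?big_mkord; last by rewrite /index_iota subn0.
rewrite -big_split /=.
apply: ler_prod => k _; have x1 := digit_ge1 (hurwitz_domain_iter k Dz) (z0 k).
move: x1; rewrite -/(orbit_digit z k); set x := int2_norm _ => x1.
have x0 : 0 < x by exact: lt_le_trans x1.
rewrite mulr_ge0 ?divr_ge0 ?exprn_ge0 ?mulr_ge0 ?powR_ge0 ?(ltW k0) ?(ltW x0) //=.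
have -> : - (b' + 1) = - (b' - 1) + - 2%:R by ring.
rewrite powRD ?(gt_eqF x0) ?implybT // powR_invn ?(ltW x0) //.
rewrite le_eqVlt; apply/orP; left; apply/eqP; field; rewrite gt_eqF //.
Qed.

(** This is [sum_jump_io] for the logarithms of the digit norms, with [h = - ln (kappa / 4)];
    [cyl_tail] is the exponential of minus the threshold there. *)
Lemma jump_cyl_cover (kappa b b' c : R) N z : 0 < kappa -> 1 < b' -> b' < b -> 1 < c ->
  Xi_io b c z -> exists w, jump_cyl kappa b' N w z.
Proof.
move=> k0 b'1 b'b c1 /Xi_io_digits [Dz z0 io].
have x1 k : 1 <= int2_norm (orbit_digit z k) :> R := digit_ge1 (hurwitz_domain_iter k Dz) (z0 k).
have x0 k : 0 < int2_norm (orbit_digit z k) :> R := lt_le_trans ltr01 (x1 k).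
pose u k : R := ln (int2_norm (orbit_digit z k)).
have [|n Nn un] := @sum_jump_io R u b b' (ln c) (- ln (kappa / 4)) N b'1 b'b (ln_gt0 c1) (fun k => ln_ge0 (x1 k)).
  apply: contra_not io; apply: sub_finite_set => n [n1 cn]; split=> //.
  by rewrite /u -ln_powR ler_ln ?posrE // powR_gt0 // (lt_trans ltr01).
exists (mkseq (orbit_digit z) n); rewrite /jump_cyl /= size_mkseq; split=> //.
have -> : cyl_tail kappa b' (mkseq (orbit_digit z) n) =
    expR (- ((b' - 1) * (\sum_(k < n) u k) + - ln (kappa / 4) * n%:R)).
  elim: {Nn un} n => [|n IHn].
    by rewrite /cyl_tail /= !big_nil big_ord0 !mulr0 addr0 oppr0 expR0.
  rewrite mkseqS /cyl_tail -cats1 big_cat big_seq1 -/(cyl_tail _ _ _) IHn big_ord_recr /=.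
  have {2}<- : expR (ln (kappa / 4)) = kappa / 4 by rewrite lnK // posrE divr_gt0.
  rewrite /powR gt_eqF //.
  by rewrite -!expRD -natr1; congr expR; rewrite -/(u n); ring.
have <- : expR (u n) = int2_norm (orbit_digit z n) by rewrite /u lnK // posrE.
rewrite -expRD -[leLHS]expR0 ler_expR.
by rewrite [_ + u n]addrC subr_ge0.
Qed.

Lemma hausdorff_measure_Xi_io (b c s : R) : 1 < b -> 1 < c -> 2 / (b + 1) < s ->
  hausdorff_measure cdist s (Xi_io b c : set C) = 0%E.
Proof.
move=> b1 c1 sb; have b10 : 0 < b + 1 by rewrite addr_gt0 // (lt_trans ltr01).
have s0 : 0 < s by apply: lt_trans sb; rewrite divr_gt0.
(* Such a [b'] exists because [(b + 1) * s > 2]; the last condition makes the digit series of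
   exponent [t = (b' + 1) * s] converge. *)
have [b' [b'1 b'b b's]] : exists b', [/\ 1 < b', b' < b & 2 < (b' + 1) * s].
  pose m := Num.max 1 (2 / s - 1).
  have mb : m < b.
    rewrite gt_max b1 /= ltrBlDr ltr_pdivrMr // mulrC.
    by move: sb; rewrite ltr_pdivrMr // mulrC [s * _]mulrC.
  have m1 : 1 <= m by rewrite le_max lexx.
  have m2 : 2 / s - 1 <= m by rewrite le_max lexx orbT.
  exists ((m + b) / 2); split; [lra|lra|].
  rewrite -ltr_pdivrMr //; lra.
pose t := (b' + 1) * s.
have [Z HZ] := @sum_int2_powRN_le R t b's.
have Z0 : 0 <= Z by have := HZ [::] isT; rewrite big_nil.
(* Chosen so that the weights [g a] of distinct digits add up to at most 1/2. *)
pose kappa := (2 * (Z + 1))^-1 `^ s^-1.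
have k0 : 0 < kappa by rewrite powR_gt0 // invr_gt0 mulr_gt0 // ltr_wpDl.
have ks : kappa `^ s = (2 * (Z + 1))^-1.
  by rewrite -powRrM mulVf ?gt_eqF // powRr1 // invr_ge0 mulr_ge0 // addr_ge0.
pose g a := kappa `^ s * (int2_norm a : R) `^ (- t).
have g0 a : 0 <= g a by rewrite mulr_ge0 ?powR_ge0.
have gs r : uniq r -> \sum_(a <- r) g a <= 2^-1.
  move=> ur; rewrite -mulr_sumr ks; apply: le_trans (ler_wpM2l _ (HZ r ur)) _.
    by rewrite invr_ge0 mulr_ge0 // addr_ge0.
  by rewrite mulrC ler_pdivrMr ?mulr_gt0 ?ltr_wpDl // mulrA mulVf // mul1r lerDl.
apply: hausdorff_measure_eq0 => // [|e e0]; first exact: cdist_ge0.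
pose N := (Num.truncn (4 `^ s * 2 / e)).+1.
pose d w : R := 4 * \prod_(a <- w) (kappa * int2_norm a `^ (- (b' + 1))).
have d0 w : 0 <= d w.
  by rewrite mulr_ge0 // prodr_ge0 // => a _; rewrite mulr_ge0 ?powR_ge0 // ltW.
have ds w : d w `^ s = 4 `^ s * \prod_(a <- w) g a.
  rewrite powRM //; last by rewrite prodr_ge0 // => a _; rewrite mulr_ge0 ?powR_ge0 // ltW.
  congr (_ * _); elim: w => [|a w IHw]; first by rewrite !big_nil powR1.
  rewrite !big_cons powRM ?IHw; last first.
  - by rewrite prodr_ge0 // => ? _; rewrite mulr_ge0 ?powR_ge0 // ltW.
  - by rewrite mulr_ge0 ?powR_ge0 // ltW.
  - by congr (_ * _); rewrite /g powRM ?powR_ge0 ?(ltW k0) // -powRrM mulNr.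
(* For words shorter than [N] the set is empty, so the diameter bound may be 0. *)
exists (seq (int * int)), (jump_cyl kappa b' N), (fun w => if (N <= size w)%N then d w else 0).
split=> [z Xz|w|w x y Vx Vy|r ur].
- by have [w Vw] := jump_cyl_cover N k0 b'1 b'b c1 Xz; exists w.
- by case: ifP.
- by have [_ _ _ -> _] := Vx; exact: jump_cyl_diam Vx Vy.
rewrite (bigID (fun w => (N <= size w)%N)) /= [X in _ + X]big1 ?addr0; last first.
  by move=> w /negbTE ->; rewrite powR0 // gt_eqF.
under eq_bigr => w Nw do rewrite Nw ds.
rewrite -mulr_sumr -big_filter.
apply: (@le_trans _ _ (4 `^ s * (2 * 2^-1 ^+ N))).
  rewrite ler_wpM2l ?powR_ge0 //; apply: sum_prod_tail_le => //; first exact: filter_uniq.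
  by move=> w; rewrite mem_filter => /andP[].
rewrite mulrA exprVn ler_pdivrMr ?exprn_gt0 // [e * _]mulrC -ler_pdivrMr //.
apply: le_trans (ltW (truncnS_gt _)) _.
by rewrite -natrX ler_nat ltnW // ltn_expl.
Qed.

End UpperBound.

(** * Points with prescribed large digits, and separation of cylinders *)

Section Expansion.
Context {R : realType}.
Local Notation C := (R[i]).
Local Notation normc := Normc.normc.
Implicit Types (z w : C) (a : int * int) (x : nat -> int * int).

(** The intervals of centre [u n] and radius [e n] meet pairwise, so the supremum of their left ends
    lies in all of them. *)
Lemma sup_limit (u e : nat -> R) :
  (forall n m, (n <= m)%N -> `|u n - u m| <= e n) -> exists l, forall n, `|u n - l| <= e n.
Proof.
move=> ue; pose S := [set u n - e n | n in [set: nat]].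
have le_S n m : u n - e n <= u m + e m.
  have [nm|mn] := leqP n m.
    have := ue _ _ nm; have := ue _ _ (leqnn m); rewrite subrr normr0 ler_norml; lra.
  have := ue _ _ (ltnW mn); have := ue _ _ (leqnn n); rewrite subrr normr0 ler_norml; lra.
exists (sup S) => n.
have S1 : u n - e n <= sup S.
  apply: ub_le_sup; last by exists n.
  by exists (u 0%N + e 0%N) => _ [k _ <-].
have S2 : sup S <= u n + e n.
  by apply: ge_sup => [|_ [k _ <-] //]; exists (u 0%N - e 0%N), 0%N.
by rewrite ler_norml; lra.
Qed.

Lemma le_normc_gintD a z : int2_norm a - normc z <= normc (gint a + z).
Proof.
have := Re_le_normc (gint a + z); have := Im_le_normc (gint a + z).
have := Re_le_normc z; have := Im_le_normc z.
rewrite lerBlDr /int2_norm ge_max; case: a => p q; case: z => u v /=.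
by rewrite !ler_norml; move: (p%:~R : R) (q%:~R : R) => P Q; lra.
Qed.

(** The finite continued fraction with the [n] digits from [x k] on. Keeping the start [k] variable
    makes the shift relation available in the limit. *)
Fixpoint finite_cf x k n : C :=
  if n is m.+1 then (gint (x k) + finite_cf x k.+1 m)^-1 else 0.

Lemma gintD_neq0 a z : 4 <= int2_norm a :> R -> normc z <= 2^-1 -> gint a + z != 0 :> C.
Proof.
move=> a4 z1; apply/eqP => az; have := le_normc_gintD a z; rewrite az Normc.normc0; lra.
Qed.

Lemma normc_gintDV a z : 4 <= int2_norm a :> R -> normc z <= 2^-1 -> normc (gint a + z)^-1 <= 3^-1.
Proof.
move=> a4 z1; rewrite Normc.normcV lef_pV2 ?posrE ?normc_gt0 ?gintD_neq0 //.
by have := le_normc_gintD a z; lra.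
Qed.

(** Both inverses have modulus at most 1/3, so the inverse branch contracts by 1/9. *)
Lemma normc_gintDVB a z w : 4 <= int2_norm a :> R -> normc z <= 2^-1 -> normc w <= 2^-1 ->
  normc ((gint a + z)^-1 - (gint a + w)^-1) <= 9^-1 * normc (z - w).
Proof.
move=> a4 z1 w1; have z0 := gintD_neq0 a4 z1; have w0 := gintD_neq0 a4 w1.
have -> : (gint a + z)^-1 - (gint a + w)^-1 = (gint a + z)^-1 * (gint a + w)^-1 * (w - z).
  by field; rewrite z0 w0.
rewrite !Normc.normcM normcB ler_wpM2r ?normc_ge0 //.
have -> : (9^-1 : R) = 3^-1 * 3^-1 by field.
by apply: ler_pM; rewrite ?normc_ge0 ?normc_gintDV.
Qed.

(** The finite continued fractions starting at [k] converge to some [p k] with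
    [p k = (gint (x k) + p k.+1)^-1]. Since [p k.+1] has modulus below 1/2, rounding recovers [x k],
    and the Gauss map sends [p k] to [p k.+1]. *)
Lemma exists_expansion x : (forall k, 4 <= int2_norm (x k) :> R) ->
  exists z : C, [/\ hurwitz_domain z, forall k, iter k gauss_map z != 0
    & forall k, orbit_digit z k = x k].
Proof.
move=> x4.
have cf_le n k : normc (finite_cf x k n) <= 3^-1.
  elim: n k => [|n IHn] k; first by rewrite [finite_cf _ _ _]/= Normc.normc0 invr_ge0.
  by apply: normc_gintDV => //; apply: le_trans (IHn _) _; lra.
have cf_le2 n k : normc (finite_cf x k n) <= 2^-1 by apply: le_trans (cf_le _ _) _; lra.
have cauchy n m k : (n <= m)%N ->
    normc (finite_cf x k n - finite_cf x k m) <= 9^-1 ^+ n.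
  elim: n m k => [|n IHn] m k nm.
    by rewrite [finite_cf x k 0]/= sub0r complex.normcN expr0 (le_trans (cf_le _ _)) //; lra.
  case: m nm => // m nm /=; rewrite exprS.
  by apply: le_trans (normc_gintDVB _ _ _) _ => //; rewrite ler_wpM2l ?invr_ge0 // IHn.
have lim k : exists p : C, forall n, normc (finite_cf x k n - p) <= 2 * 9^-1 ^+ n.
  have cRe n m : (n <= m)%N ->
      `|complex.Re (finite_cf x k n) - complex.Re (finite_cf x k m)| <= 9^-1 ^+ n.
    move=> nm; apply: le_trans (cauchy n m k nm); apply: le_trans (Re_le_normc _).
    by case: (finite_cf x k n) => ? ?; case: (finite_cf x k m).
  have cIm n m : (n <= m)%N ->
      `|complex.Im (finite_cf x k n) - complex.Im (finite_cf x k m)| <= 9^-1 ^+ n.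
    move=> nm; apply: le_trans (cauchy n m k nm); apply: le_trans (Im_le_normc _).
    by case: (finite_cf x k n) => ? ?; case: (finite_cf x k m).
  have [l Hl] := sup_limit cRe; have [l' Hl'] := sup_limit cIm.
  exists (Complex l l') => n; apply: le_trans (normc_le_ReIm _) _.
  have := Hl n; have := Hl' n; case: (finite_cf x k n) => u v /=; lra.
have [p Hp] := choice lim.
(* Two digits suffice, as 2/81 + 1/3 < 1/2; one digit would give only 2/9 + 1/3. *)
have p_le k : normc (p k) < 2^-1.
  have := complex.le_normcD (p k - finite_cf x k 2) (finite_cf x k 2).
  rewrite subrK normcB; have := Hp k 2%N; have := cf_le 2%N k; rewrite expr2; lra.
have pE k : p k = (gint (x k) + p k.+1)^-1.
  apply/eqP; rewrite -subr_eq0; apply/eqP; apply: Normc.eq0_normc.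
  apply/eqP; rewrite eq_le normc_ge0 andbT; apply/ler_addgt0Pr => e e0; rewrite add0r.
  pose n := (Num.truncn (4 / e)).+1.
  have := complex.le_normcD (p k - finite_cf x k n.+1) (finite_cf x k n.+1 - (gint (x k) + p k.+1)^-1).
  rewrite addrA subrK => /le_trans; apply.
  have H1 := Hp k n.+1; rewrite normcB in H1.
  have H2 := normc_gintDVB (x4 k) (cf_le2 n k.+1) (ltW (p_le k.+1)).
  apply: le_trans (lerD H1 H2) _; have H3 := Hp k.+1 n.
  apply: (@le_trans _ _ (4 * 9^-1 ^+ n)).
    rewrite exprS; have : 0 <= 9^-1 ^+ n :> R by rewrite exprn_ge0 // invr_ge0.
    by lra.
  rewrite exprVn ler_pdivrMr ?exprn_gt0 // [e * _]mulrC -ler_pdivrMr //.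
  apply: le_trans (ltW (truncnS_gt _)) _.
  by rewrite -natrX ler_nat ltnW // ltn_expl.
have p0 k : p k != 0 by rewrite pE invr_eq0 gintD_neq0 // ltW.
have pD k : hurwitz_domain (p k).
  apply/hurwitz_domainP; have := p_le k; have := Re_le_normc (p k); have := Im_le_normc (p k).
  by rewrite !ler_norml; lra.
have pd k : digit (p k) = x k.
  have : hurwitz_domain (p k.+1) by [].
  move/hurwitz_domainP; rewrite /digit (pE k) invrK; case: (x k) => P Q; case: (p k.+1) => u v /=.
  move=> /andP[/andP[u1 u2] /andP[v1 v2]]; congr pair; apply/eqP; rewrite floor_eq intrD; lra.
have pg k : gauss_map (p k) = p k.+1.
  by rewrite gauss_mapE // pd pE invrK addrC addKr.
have pi k : iter k gauss_map (p 0%N) = p k by elim: k => //= k ->.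
by exists (p 0%N); split=> // k; rewrite ?/orbit_digit pi.
Qed.

(** The counterpart of [normc_cylinder_le]: the identity [normc_gauss] is iterated with all moduli
    bounded below by [(M k)^-1]. *)
Lemma normc_cylinder_ge (M : nat -> R) z w n : (forall k, 0 < M k) ->
  (forall k, [/\ iter k gauss_map z != 0, iter k gauss_map w != 0,
     (normc (iter k gauss_map z))^-1 <= M k & (normc (iter k gauss_map w))^-1 <= M k]) ->
  (forall k, (k < n)%N -> orbit_digit z k = orbit_digit w k) ->
  \prod_(k < n) (M k ^+ 2)^-1 * normc (iter n gauss_map z - iter n gauss_map w) <= normc (z - w).
Proof.
move=> M0 H; elim: n => [|n IHn] dzw; first by rewrite big_ord0 mul1r.
apply: le_trans (IHn _) => [|k kn]; last exact/dzw/ltnW.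
have [zn wn zM wM] := H n.
rewrite big_ord_recr /= -mulrA ler_wpM2l //.
  by apply: prodr_ge0 => k _; rewrite invr_ge0 exprn_ge0 // ltW.
rewrite (normc_gauss zn wn (dzw n (ltnSn n))) ler_wpM2r ?normc_ge0 // expr2 invfM.
apply: ler_pM; rewrite ?invr_ge0 ?(ltW (M0 n)) //.
  by rewrite -[leRHS]invrK lef_pV2 ?posrE ?invr_gt0 ?normc_gt0.
by rewrite -[leRHS]invrK lef_pV2 ?posrE ?invr_gt0 ?normc_gt0.
Qed.

End Expansion.

(** * Descent in a tree of words along an insufficiently covered branch *)

Section Greedy.
Context {R : realType} {A : eqType}.
Implicit Types (D : nat -> seq A) (v w : seq A).

(** Here [mu] is a mass and [g] the part of it that is covered. If [mu <= g] held at every child of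
    [v], summation would give [mu v <= g v]; so strict inequality passes to some child. *)
Lemma exists_branch D (g : seq A -> \bar R) (mu : seq A -> R) :
  (forall v, \sum_(a <- D (size v)) g (rcons v a) <= g v)%E ->
  (forall v, mu v = \sum_(a <- D (size v)) mu (rcons v a)) ->
  (g [::] < (mu [::])%:E)%E ->
  exists2 x : nat -> A, forall k, x k \in D k & forall n, (g (mkseq x n) < (mu (mkseq x n))%:E)%E.
Proof.
move=> gD muD g0.
have step v : (g v < (mu v)%:E)%E ->
    exists2 a, a \in D (size v) & (g (rcons v a) < (mu (rcons v a))%:E)%E.
  move=> gv; apply: contrapT => noa; move: gv; apply/negP; rewrite -leNgt.
  apply: le_trans (gD v); rewrite muD -sumEFin big_seq [leRHS]big_seq.
  by apply: lee_sum => a Da; rewrite leNgt; apply/negP => ga; apply: noa; exists a.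
(* A default letter, which makes the choice function total. *)
have [a0 _ _] := step _ g0.
have step' v : exists a, (g v < (mu v)%:E)%E ->
    a \in D (size v) /\ (g (rcons v a) < (mu (rcons v a))%:E)%E.
  have [/step [a Da ga]|nv] := boolP (g v < (mu v)%:E)%E; first by exists a.
  by exists a0.
have [f fP] := choice step'.
pose V n := iter n (fun v => rcons v (f v)) [::]; pose x k := f (V k).
have VE n : V n = mkseq x n by elim: n => // n IHn; rewrite mkseqS -IHn.
have gV n : (g (V n) < (mu (V n))%:E)%E.
  by elim: n => // n /fP [].
exists x => [k|n]; last by rewrite -VE.
by have [] := fP _ (gV k); rewrite {2}VE size_mkseq.
Qed.

(** At most one letter continues [v] inside [w], and it occurs only once in the alphabet. *)
Lemma sum_prefix_rcons_le D v w : uniq (D (size v)) ->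
  \sum_(a <- D (size v)) (prefix (rcons v a) w)%:R <= (prefix v w)%:R :> R.
Proof.
move=> uD; have [/prefixP [t ->]|vw] := boolP (prefix v w); last first.
  rewrite big1 // => a _; case: (boolP (prefix (rcons v a) w)) => // /prefixP [t wE].
  by move: vw; rewrite wE cat_rcons prefix_prefix.
under eq_bigr => a _ do rewrite -cats1 prefix_catr // eqxx /=.
case: t => [|b t]; first by rewrite big1.
under eq_bigr => a _ do rewrite prefix_cons prefix0s andbT.
rewrite -natr_sum ler_nat (eq_bigr (fun a => if a == b then 1 else 0)%N); last first.
  by move=> a _; case: eqP.
by rewrite -big_mkcond sum1_count count_uniq_mem // leq_b1.
Qed.

End Greedy.

(** * The Cantor set of points with digits in given boxes *)

Section DigitBoxes.
Context {R : realType} (N : nat -> nat).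
Hypothesis N_ge8 : forall k, (8 <= N k)%N.
Local Notation C := (R[i]).
Local Notation normc := Normc.normc.
Implicit Types (z : C) (U : set C) (w : seq (int * int)) (d : R).

Definition digit_box k : seq (int * int) :=
  [seq (Posz i, Posz j) | i <- iota (N k) (N k), j <- iota (N k) (N k)].

Definition box_set : set C :=
  [set z | [/\ hurwitz_domain z, forall k, iter k gauss_map z != 0
             & forall k, orbit_digit z k \in digit_box k]].

(** A lower bound for the distance between points of [box_set] in different cylinders of length [n].
    The factors [4 * N k] bound the inverses of the iterates; the 1/2 is what the tails leave of a
    digit difference. *)
Definition box_gap n : R := 2^-1 * \prod_(k < n) ((4 * (N k)%:R) ^+ 2)^-1.

Definition box_mass n : R := \prod_(k < n) ((N k)%:R ^+ 2)^-1.

Let N_gt0 k : 0 < (N k)%:R :> R.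
Proof. by rewrite ltr0n; exact: leq_trans (N_ge8 k). Qed.

Lemma digit_boxP k a : a \in digit_box k ->
  [/\ (N k)%:R <= a.1%:~R :> R, a.1%:~R <= (N k)%:R * 2 - 1 :> R,
      (N k)%:R <= a.2%:~R :> R & a.2%:~R <= (N k)%:R * 2 - 1 :> R].
Proof.
have bound i : i \in iota (N k) (N k) -> (N k)%:R <= i%:R :> R /\ i%:R <= (N k)%:R * 2 - 1 :> R.
  rewrite mem_iota => /andP[Ni iN]; rewrite ler_nat; split=> //.
  by rewrite lerBrDr natr1 -natrM ler_nat muln2 -addnn.
by case/allpairsP => -[i j] [/= /bound [? ?] /bound [? ?] ->].
Qed.

Lemma size_digit_box k : size (digit_box k) = (N k * N k)%N.
Proof. by rewrite size_allpairs size_iota. Qed.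

Lemma uniq_digit_box k : uniq (digit_box k).
Proof.
by apply: allpairs_uniq; rewrite ?iota_uniq // => -[i j] [i' j'] _ _ /= [-> ->].
Qed.

Lemma digit_box_norm k a : a \in digit_box k -> (N k)%:R <= int2_norm a :> R.
Proof.
by case/digit_boxP => a1 _ _ _; rewrite le_max (le_trans a1) ?ler_norm.
Qed.

Lemma digit_box_norm_ge8 k a : a \in digit_box k -> 8 <= int2_norm a :> R.
Proof. by move/digit_box_norm; apply: le_trans; rewrite ler_nat. Qed.

Lemma box_set_normc_le z k : box_set z -> normc (iter k gauss_map z) <= 4^-1.
Proof.
case=> Dz z0 zb; have := normc_digit_le (hurwitz_domain_iter k Dz) (z0 k).
rewrite -/(orbit_digit z k) => /le_trans; apply.
have := digit_box_norm_ge8 (zb k); set x := int2_norm _ => x8.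
by rewrite ler_pdivrMr; lra.
Qed.

Lemma box_set_normcV_le z k : box_set z -> (normc (iter k gauss_map z))^-1 <= 4 * (N k)%:R.
Proof.
move=> bz; have [Dz z0 zb] := bz; rewrite -Normc.normcV.
have -> : (iter k gauss_map z)^-1 = gint (orbit_digit z k) + iter k.+1 gauss_map z.
  by rewrite iterS gauss_mapE // addrC subrK.
apply: le_trans (complex.le_normcD _ _) _; apply: le_trans (lerD (normc_le_ReIm _) (box_set_normc_le _ bz)) _.
have [a1 a2 a3 a4] := digit_boxP (zb k); have N0 := N_gt0 k.
by rewrite /= !ger0_norm ?(le_trans (ltW N0)) //; lra.
Qed.

Lemma box_gapS m : box_gap m.+1 = box_gap m * ((4 * (N m)%:R) ^+ 2)^-1.
Proof. by rewrite /box_gap big_ord_recr /= mulrA. Qed.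

Lemma box_gap_gt0 n : 0 < box_gap n.
Proof.
rewrite mulr_gt0 ?invr_gt0 // prodr_gt0 // => k _.
by rewrite invr_gt0 exprn_gt0 // mulr_gt0.
Qed.

Lemma box_gapS_le m : box_gap m.+1 <= box_gap m * 2^-1.
Proof.
rewrite box_gapS ler_wpM2l ?(ltW (box_gap_gt0 m)) // lef_pV2 ?posrE ?exprn_gt0 ?mulr_gt0 //.
have : 8 <= (N m)%:R :> R by rewrite ler_nat.
by rewrite expr2; nra.
Qed.

Lemma box_gap_le_expr n : box_gap n <= 2^-1 ^+ n.
Proof.
elim: n => [|n IHn]; first by rewrite /box_gap big_ord0 expr0; lra.
by apply: le_trans (box_gapS_le n) _; rewrite exprSr ler_wpM2r.
Qed.

Lemma box_gap_anti m n : (m <= n)%N -> box_gap n <= box_gap m.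
Proof.
move=> /subnKC <-; elim: (n - m)%N => [|k IHk]; rewrite ?addn0 // addnS.
by apply: le_trans (box_gapS_le _) _; have := box_gap_gt0 (m + k); lra.
Qed.

(** At the first disagreement the inverses of the iterates differ by the digit difference, of norm
    at least 1, plus tails of total modulus at most 1/2. So at least half of the digit difference
    survives. *)
Lemma box_set_sep z z' m : box_set z -> box_set z' ->
  (forall k, (k < m)%N -> orbit_digit z k = orbit_digit z' k) ->
  orbit_digit z m != orbit_digit z' m ->
  box_gap m.+1 * int2_norm (orbit_digit z m - orbit_digit z' m) <= normc (z - z').
Proof.
move=> bz bz' agree neq; have [Dz z0 zb] := bz; have [Dz' z0' zb'] := bz'.
apply: le_trans (normc_cylinder_ge (M := fun k => 4 * (N k)%:R) _ _ agree); last 2 first.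
- by move=> k; rewrite mulr_gt0.
- by move=> k; split=> //; exact: box_set_normcV_le.
rewrite /box_gap big_ord_recr /= mulrCA -!mulrA ler_wpM2l //.
  by apply: prodr_ge0 => k _; rewrite invr_ge0 exprn_ge0 // mulr_ge0.
set y := iter m gauss_map z; set y' := iter m gauss_map z'.
have -> : y - y' = y * y' * (y'^-1 - y^-1) by field; rewrite z0 z0'.
have -> : y'^-1 - y^-1 = gint (orbit_digit z' m - orbit_digit z m) +
    (iter m.+1 gauss_map z' - iter m.+1 gauss_map z).
  rewrite !iterS !gauss_mapE // -/y -/y' -/(orbit_digit z m) -/(orbit_digit z' m).
  have -> : gint (orbit_digit z' m - orbit_digit z m) =
     gint (orbit_digit z' m) - gint (orbit_digit z m) :> C.
    by rewrite /gint /= !intrD !mulrNz.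
  by ring.
rewrite !Normc.normcM mulrCA expr2 invfM; apply: ler_pM.
- by rewrite mulr_ge0 // invr_ge0 mulr_ge0.
- by rewrite mulr_ge0 ?int2_norm_ge0.
- have V (x : C) : x != 0 -> (normc x)^-1 <= 4 * (N m)%:R -> (4 * (N m)%:R)^-1 <= normc x.
    by move=> x0 xN; rewrite -[leRHS]invrK lef_pV2 ?posrE ?invr_gt0 ?normc_gt0 ?mulr_gt0.
  by apply: ler_pM; rewrite ?invr_ge0 ?mulr_ge0 //; apply: V; rewrite ?z0 ?z0' ?box_set_normcV_le.
apply: le_trans (le_normc_gintD _ _).
have := complex.le_normcD (iter m.+1 gauss_map z') (- iter m.+1 gauss_map z).
rewrite complex.normcN; have := box_set_normc_le m.+1 bz; have := box_set_normc_le m.+1 bz'.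
have -> : int2_norm (orbit_digit z m - orbit_digit z' m) =
          int2_norm (orbit_digit z' m - orbit_digit z m) :> R.
  by rewrite -[in LHS]opprB /int2_norm /= ![(- _)%:~R]mulrNz !normrN.
have : 1 <= int2_norm (orbit_digit z' m - orbit_digit z m) :> R.
  by apply: int2_norm_ge1; rewrite subr_eq0 eq_sym.
lra.
Qed.

Definition hit U n w : Prop := exists2 z, box_set z /\ U z & w = mkseq (orbit_digit z) n.

Definition hit_words U n := [seq w <- words digit_box n | `[< hit U n w >]].

(** Since [d < box_gap m], all points of [U] in [box_set] share their first [m] digits, and a hit
    word is determined by its last letter. That letter lies in [digit_box m], and within
    [d / box_gap m.+1] of the last letter of a fixed hit word; the two bounds count these
    possibilities. *)
Lemma size_hit_words U d m : (forall x y, U x -> U y -> normc (x - y) <= d) ->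
  box_gap m.+1 <= d < box_gap m ->
  (size (hit_words U m.+1))%:R <= (N m)%:R ^+ 2 :> R /\
  (size (hit_words U m.+1))%:R <= (3 * (d / box_gap m.+1)) ^+ 2.
Proof.
move=> Ud /andP[d1 d2]; set W := hit_words U m.+1.
have uW : uniq W by apply/filter_uniq/uniq_words; exact: uniq_digit_box.
have HW w : w \in W -> hit U m.+1 w by rewrite mem_filter => /andP[/asboolP].
case WE : W => [|w0 W'].
  by rewrite /= !sqr_ge0.
have [z0 [bz0 Uz0] w0E] : hit U m.+1 w0 by apply: HW; rewrite WE mem_head.
rewrite -WE.
have agree z k : box_set z -> U z -> (k <= m)%N ->
    forall j, (j < k)%N -> orbit_digit z j = orbit_digit z0 j.
  move=> bz Uz; elim: k => // k IHk km j; rewrite ltnS leq_eqVlt => /orP[/eqP -> {j}|]; last first.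
    by apply: IHk; exact: ltnW.
  apply/eqP; apply: contraT => neq.
  have := box_set_sep bz bz0 (IHk (ltnW km)) neq; have := Ud _ _ Uz Uz0.
  have : box_gap m <= box_gap k.+1 by exact: box_gap_anti.
  have : 1 <= int2_norm (orbit_digit z k - orbit_digit z0 k) :> R.
    by apply: int2_norm_ge1; rewrite subr_eq0.
  have := box_gap_gt0 k.+1; nra.
pose f w := nth (0, 0) w m.
have fW w : w \in W -> exists z, [/\ box_set z, U z, w = mkseq (orbit_digit z) m.+1 & f w = orbit_digit z m].
  by case/HW => z [bz Uz] wE; exists z; split=> //; rewrite /f wE nth_mkseq.
have uf : uniq (map f W).
  rewrite map_inj_in_uniq // => w w' /fW [z [bz Uz wE fE]] /fW [z' [bz' Uz' wE' fE']].
  rewrite fE fE' wE wE' !mkseqS => ->; congr rcons; apply/eq_in_map => j.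
  by rewrite mem_iota add0n => /andP[_ jm]; rewrite (agree z m) // (agree z' m).
have sizeN : (size W <= N m * N m)%N.
  rewrite -(size_map f) -size_digit_box; apply: uniq_leq_size => // _ /mapP [w /fW [z [[_ _ bz] _ _ ->]] ->].
  exact: bz.
split; first by rewrite expr2 -natrM ler_nat.
set r := d / box_gap m.+1; have r1 : 1 <= r by rewrite ler_pdivlMr ?box_gap_gt0 // mul1r.
(* The nearby letters fill a square of side [2 * t + 1], which is at most [3 * r] because
   [r >= 1]. *)
pose t := Num.truncn r; have tr : t%:R <= r by rewrite -truncn_ge_nat // (le_trans _ r1).
pose s (p : int) := [seq p - t%:Z + Posz i | i <- iota 0 (2 * t + 1)].
have mem_s (p q : int) : `|q%:~R - p%:~R| <= r -> q \in s p.
  move=> pq; have : `|q - p|%:~R < t.+1%:Z%:~R :> R.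
    by rewrite intr_norm intrD mulrNz; apply: le_lt_trans pq (truncnS_gt r).
  rewrite ltr_int => qp; apply/mapP; exists (absz (q - p + t%:Z)%R); first by rewrite mem_iota; lia.
  by lia.
have size_s p : size (s p) = (2 * t + 1)%N by rewrite size_map size_iota.
have sizeR : (size W <= (2 * t + 1) * (2 * t + 1))%N.
  rewrite -(size_map f) -{1}(size_s (orbit_digit z0 m).1) -(size_s (orbit_digit z0 m).2).
  rewrite -(size_allpairs pair); apply: uniq_leq_size => // _ /mapP [w /fW [z [bz Uz _ ->]] ->].
  have : int2_norm (orbit_digit z m - orbit_digit z0 m) <= r :> R.
    rewrite ler_pdivlMr ?box_gap_gt0 // mulrC.
    have [->|neq] := eqVneq (orbit_digit z m) (orbit_digit z0 m).
      rewrite subrr /int2_norm /= normr0 maxxx mulr0; apply: le_trans d1.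
      exact/ltW/box_gap_gt0.
    apply: le_trans (Ud _ _ Uz Uz0); apply: box_set_sep => // k km.
    exact: (agree z m).
  rewrite ge_max /= !intrD !mulrNz => /andP[h1 h2].
  by rewrite [orbit_digit z m]surjective_pairing; apply: allpairs_f; exact: mem_s.
apply: (@le_trans _ _ (((2 * t + 1) * (2 * t + 1))%N%:R)); first by rewrite ler_nat.
have t0 : 0 <= t%:R :> R by [].
by rewrite natrM natrD natrM -expr2; apply: lerXn2r; rewrite ?nnegrE; lra.
Qed.

End DigitBoxes.

(** * The mass of a set of given diameter, and the impossibility of cheap covers *)

Section MassDistribution.
Context {R : realType} (N : nat -> nat).
Hypothesis N_ge8 : forall k, (8 <= N k)%N.
Local Notation C := (R[i]).
Local Notation normc := Normc.normc.
Implicit Types (z : C) (U : set C) (v w : seq (int * int)) (d : R).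

Let N_gt0 k : 0 < (N k)%:R :> R.
Proof. by rewrite ltr0n; exact: leq_trans (N_ge8 k). Qed.

Lemma box_mass_gt0 n : 0 < box_mass N n :> R.
Proof. by rewrite prodr_gt0 // => k _; rewrite invr_gt0 exprn_gt0. Qed.

Lemma hit_mass_le (s K : R) U d m : 0 < s < 2 -> 0 < d ->
  (forall x y, U x -> U y -> normc (x - y) <= d) ->
  box_gap N m.+1 <= d < box_gap N m ->
  box_mass N m.+1 * ((N m)%:R `^ (2 - s) * (3 / box_gap N m.+1) `^ s) <= K ->
  box_mass N m.+1 * (size (hit_words N U m.+1))%:R <= K * d `^ s.
Proof.
move=> s02 d0 Ud dm Km; have [c1 c2] := size_hit_words N_ge8 Ud dm.
apply: le_trans (ler_wpM2r (powR_ge0 _ _) Km).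
rewrite -!mulrA ler_wpM2l ?(ltW (box_mass_gt0 _)) //.
have g0 : 0 <= 3 / box_gap N m.+1 :> R by rewrite divr_ge0 // ltW // box_gap_gt0.
rewrite -powRM ?(ltW d0) //; apply: sqr_min_interpolation => //.
- by rewrite mulr_ge0 // ltW.
- by rewrite mulrAC -mulrA.
Qed.

Lemma box_mass_split v : box_mass N (size v) =
  \sum_(a <- digit_box N (size v)) box_mass N (size (rcons v a)) :> R.
Proof.
under eq_bigr do rewrite size_rcons; rewrite big_const_seq iter_addr_0 count_predT.
rewrite size_digit_box /box_mass big_ord_recr /= -[_ *+ (N _ * N _)]mulr_natr -mulrA natrM -expr2.
by rewrite mulVf ?mulr1 // gt_eqF // exprn_gt0.
Qed.

Lemma box_set_cover (s K : R) : 0 < s < 2 ->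
  (forall m, box_mass N m.+1 * ((N m)%:R `^ (2 - s) * (3 / box_gap N m.+1) `^ s) <= K) ->
  exists2 eta, 0 < eta & forall (U : nat -> set C) (d : nat -> R),
    box_set N `<=` \bigcup_i U i -> (forall i, 0 < d i) ->
    (forall i x y, U i x -> U i y -> cdist x y <= d i) ->
    (forall n, \sum_(i < n) d i `^ s <= eta) -> False.
Proof.
move=> s02 HK; have /andP[s0 s2] := s02.
have K0 : 0 <= K.
  apply: le_trans (HK 0%N); rewrite mulr_ge0 ?(ltW (box_mass_gt0 _)) //.
  by rewrite mulr_ge0 ?powR_ge0.
(* The first bound forces [d i <= 1/4], below [box_gap N 0 = 1/2], so every set has a level; the
   second keeps the covered mass at most 1/2. *)
pose eta := Num.min (4^-1 `^ s) (2 * (K + 1))^-1; exists eta.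
  by rewrite lt_min powR_gt0 ?invr_gt0 //= mulr_gt0 // ltr_wpDl.
move=> U d EU d0 Ud dsum.
have d_small i : d i <= 4^-1.
  rewrite leNgt; apply/negP => di.
  have := dsum i.+1; rewrite big_ord_recr /=; apply/negP; rewrite -ltNge.
  apply: (@le_lt_trans _ _ (4^-1 `^ s)); first by rewrite ge_min lexx.
  apply: (@lt_le_trans _ _ (d i `^ s)); last by rewrite lerDr sumr_ge0 // => k _; exact: powR_ge0.
  by rewrite gt0_ltr_powR // nnegrE ?invr_ge0 // ltW.
have level i : exists m, box_gap N m.+1 <= d i < box_gap N m.
  have ex : exists n, box_gap N n <= d i.
    exists (Num.truncn (d i)^-1).+1; apply: le_trans (box_gap_le_expr N_ge8 _) _.
    rewrite exprVn -[leRHS]invrK lef_pV2 ?posrE ?invr_gt0 ?exprn_gt0 //.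
    apply: le_trans (ltW (truncnS_gt _)) _.
    by rewrite -natrX ler_nat ltnW // ltn_expl.
  case: (ex_minnP ex) => -[|m] gm minm; last first.
    by exists m; rewrite gm /= ltNge; apply/negP => /minm; rewrite ltnn.
  by move: gm; rewrite /box_gap big_ord0 mulr1; have := d_small i; lra.
have [l lP] := choice level.
(* The mass of the cylinders inside that of [v], at the level of [U i], which [U i] meets. Once [v]
   is longer than that level this is 0. *)
pose cov i v : R := box_mass N (l i).+1 * \sum_(w <- hit_words N (U i) (l i).+1) (prefix v w)%:R.
have cov0 i v : 0 <= cov i v.
  by rewrite mulr_ge0 ?(ltW (box_mass_gt0 _)) // sumr_ge0.
pose g v := (\sum_(i <oo) (cov i v)%:E)%E.
have [||x xD gx] := @exists_branch R _ (digit_box N) g (fun v => box_mass N (size v)) _ box_mass_split _.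
- move=> v; rewrite /g -nneseries_sum => [|a j _]; last by rewrite lee_fin.
  apply: lee_nneseries => [i _ _|i _]; first by apply: sume_ge0 => a _; rewrite lee_fin.
  rewrite sumEFin lee_fin /cov -mulr_sumr ler_wpM2l ?(ltW (box_mass_gt0 _)) //.
  rewrite exchange_big /=; apply: ler_sum => w _.
  by apply: sum_prefix_rcons_le; exact: uniq_digit_box.
- rewrite /box_mass big_ord0; apply: (@le_lt_trans _ _ (2^-1)%:E); last by rewrite lte_fin; lra.
  apply: lime_le; first by apply: is_cvg_nneseries => n _ _; rewrite lee_fin.
  apply: nearW => n; rewrite sumEFin lee_fin big_mkord.
  apply: (@le_trans _ _ (\sum_(i < n) K * d i `^ s)).
    apply: ler_sum => i _; apply: le_trans (hit_mass_le s02 (d0 i) (Ud i) (lP i) (HK _)).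
    rewrite /cov ler_wpM2l ?(ltW (box_mass_gt0 _)) //.
    under eq_bigr do rewrite prefix0s.
    by rewrite big_const_seq iter_addr_0 count_predT.
  rewrite -mulr_sumr; apply: le_trans (ler_wpM2l K0 (dsum n)) _.
  apply: (@le_trans _ _ (K * (2 * (K + 1))^-1)); first by rewrite ler_wpM2l // ge_min lexx orbT.
  by rewrite ler_pdivrMr ?mulr_gt0 ?ltr_wpDl // mulrA mulVf // mul1r lerDl.
have [|z [Dz z0 zx]] := @exists_expansion R x.
  by move=> k; apply: le_trans (digit_box_norm_ge8 N_ge8 (xD k)); lra.
have bz : box_set N z by split=> // k; rewrite zx.
have [i _ Uz] := EU _ bz.
(* At the level of [U i], the prefix of [z] is itself a hit word, so [U i] alone covers its whole
   mass, against the choice of the branch. *)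
have := gx (l i).+1; rewrite size_mkseq; apply/negP; rewrite -leNgt.
apply: (@le_trans _ _ (cov i (mkseq x (l i).+1))%:E).
  rewrite lee_fin /cov ler_peMr ?(ltW (box_mass_gt0 _)) //.
  have hx : mkseq x (l i).+1 \in hit_words N (U i) (l i).+1.
    rewrite mem_filter mkseq_words // andbT; apply/asboolP; exists z => //.
    by apply: eq_mkseq => k; rewrite zx.
  by rewrite (big_rem _ hx) /= eqxx prefix_refl lerDl sumr_ge0.
apply: le_trans (nneseries_lim_ge i.+1 _); last by move=> k _ _; rewrite lee_fin.
by rewrite big_nat_recr //= leeDr // sume_ge0 // => k _; rewrite lee_fin.
Qed.

End MassDistribution.

(** * Choice of the boxes and the lower bound for [Xi_all] *)

Section LowerBound.
Context {R : realType}.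
Local Notation C := (R[i]).
Implicit Types (b c s : R).

(** The exponent is [k.+1] because digit [k] is $a_{k+1}$; adding 8 makes up for the truncation and
    keeps the digits large. *)
Definition box_radius b c k : nat := (Num.truncn (c `^ (b ^+ k.+1)) + 8)%N.

Lemma box_radius_ge8 b c k : (8 <= box_radius b c k)%N.
Proof. exact: leq_addl. Qed.

Lemma box_radius_ge b c k : c `^ (b ^+ k.+1) <= (box_radius b c k)%:R.
Proof.
by apply: le_trans (ltW (truncnS_gt _)) _; rewrite ler_nat -addn1 leq_add2l.
Qed.

Lemma ln_box_radius_ge b c k : 1 < c -> ln c * b ^+ k.+1 <= ln (box_radius b c k)%:R.
Proof.
move=> c1; rewrite mulrC -ln_powR ler_ln ?posrE ?box_radius_ge //.
  by rewrite powR_gt0 // (lt_trans ltr01).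
by rewrite ltr0n (leq_trans _ (box_radius_ge8 _ _ _)).
Qed.

Lemma ln_box_radius_le b c k : 1 < b -> 1 < c ->
  ln (box_radius b c k)%:R <= ln c * b ^+ k.+1 + ln 9.
Proof.
move=> b1 c1; have c0 : 0 < c by rewrite (lt_trans ltr01).
rewrite mulrC -ln_powR -lnM ?posrE ?powR_gt0 // ler_ln ?posrE ?mulr_gt0 ?powR_gt0 //; last first.
  by rewrite ltr0n (leq_trans _ (box_radius_ge8 _ _ _)).
(* The power is at least 1, so adding 8 multiplies it by at most 9. *)
have x1 : 1 <= c `^ (b ^+ k.+1).
  by rewrite -(powRr0 c); apply: ler_powR; rewrite ?exprn_ge0 // ltW // (lt_trans ltr01).
have : (Num.truncn (c `^ (b ^+ k.+1)))%:R <= c `^ (b ^+ k.+1).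
  by rewrite -truncn_ge_nat // powR_ge0.
by rewrite natrD; lra.
Qed.

Lemma box_set_sub_Xi_all b c : box_set (box_radius b c) `<=` (Xi_all b c : set C).
Proof.
move=> z [Dz z0 zb]; split=> // -[//|n] _; split; first exact: z0.
apply: le_trans (box_radius_ge b c n) _.
exact: digit_box_norm (zb n).
Qed.

(** In logarithms the quantity is, up to a constant, [- (2 - 2 * s) * L m + s * ln (N m) + m * s *
    ln 16]. Both [L m * (b - 1)] and [ln (N m)] are close to [ln c * b ^+ m.+1], so the coefficient
    of [b ^+ m.+1] is [- kappa]. *)
Lemma box_mass_bound b c s : 1 < b -> 1 < c -> 0 < s < 2 / (b + 1) ->
  exists K, forall m, box_mass (box_radius b c) m.+1 *
    ((box_radius b c m)%:R `^ (2 - s) * (3 / box_gap (box_radius b c) m.+1) `^ s) <= K.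
Proof.
move=> b1 c1 /andP[s0 sb]; set N := box_radius b c.
have N0 k : 0 < (N k)%:R :> R by rewrite ltr0n (leq_trans _ (box_radius_ge8 _ _ _)).
have b10 : 0 < b - 1 by rewrite subr_gt0.
have sb2 : s * (b + 1) < 2 by rewrite -ltr_pdivlMr //; lra.
have s1 : s < 1 by nra.
have l0 : 0 < ln c by exact: ln_gt0.
pose kappa := ln c * ((2 - 2 * s) / (b - 1) - s).
(* Positivity is equivalent to [s * (b + 1) < 2]: this is where the critical exponent enters. The
   exponential then beats the linear term from the factors 16. *)
have kappa0 : 0 < kappa.
  by rewrite mulr_gt0 // subr_gt0 ltr_pdivlMr //; lra.
have [B HB] := linear_le_expr (s * ln 16) kappa0 b1.
pose L n : R := \sum_(k < n) ln (N k)%:R.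
have massE n : box_mass N n = expR (- (2 * L n)).
  rewrite /box_mass /L; elim: n => [|n IHn]; first by rewrite !big_ord0 mulr0 oppr0 expR0.
  rewrite !big_ord_recr /= IHn -[((N n)%:R ^+ 2)^-1]lnK ?posrE ?invr_gt0 ?exprn_gt0 //.
  by rewrite lnV ?posrE ?exprn_gt0 // lnXn // -expRD; congr expR; rewrite mulr2n; ring.
have gapE n : 3 / box_gap N n = expR (ln 6 + n%:R * ln 16 + 2 * L n).
  rewrite /box_gap.
  have -> : \prod_(k < n) ((4 * (N k)%:R) ^+ 2)^-1 = expR (- (n%:R * ln 16)) * box_mass N n :> R.
    rewrite /box_mass; elim: n => [|n IHn]; first by rewrite !big_ord0 mul0r oppr0 expR0 mulr1.
    have -> : - (n.+1%:R * ln 16) = - (n%:R * ln 16) + - ln 16 :> R.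
      by rewrite -[n.+1%:R]natr1; ring.
    rewrite !big_ord_recr /= IHn expRD [expR (- ln 16)]expRN lnK ?posrE //.
    by rewrite exprMn; field; rewrite !gt_eqF.
  rewrite massE !expRD lnK ?posrE // !expRN; field.
  by rewrite !gt_eqF // expR_gt0.
exists (expR (s * ln 6 + s * ln 16 + s * ln 9 + (2 - 2 * s) * ln c * b / (b - 1) + B)) => m.
have -> : (N m)%:R `^ (2 - s) = expR ((2 - s) * ln (N m)%:R) by rewrite /powR gt_eqF.
rewrite massE gapE /powR gt_eqF ?expR_gt0 // expRK -!expRD ler_expR.
have LS : L m.+1 = L m + ln (N m)%:R by rewrite /L big_ord_recr.
have Lm : ln c * ((b ^+ m.+1 - b) / (b - 1)) <= L m.
  apply: le_trans (ler_wpM2l (ltW l0) (sum_expr_ge m b1)) _.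
  by rewrite mulr_sumr; apply: ler_sum => k _; exact: ln_box_radius_ge.
have Nm : ln (N m)%:R <= ln c * b ^+ m.+1 + ln 9 by exact: ln_box_radius_le.
have bm : kappa * b ^+ m <= kappa * b ^+ m.+1.
  by rewrite ler_wpM2l ?(ltW kappa0) // exprS ler_peMl ?exprn_ge0 // ltW // (lt_trans ltr01).
have Hm := HB m.
have L2 := ler_wpM2l (_ : 0 <= 2 - 2 * s) Lm.
have N2 := ler_wpM2l (ltW s0) Nm.
have E : (2 - 2 * s) * (ln c * ((b ^+ m.+1 - b) / (b - 1))) =
  kappa * b ^+ m.+1 + s * (ln c * b ^+ m.+1) - (2 - 2 * s) * ln c * b / (b - 1).
  by rewrite /kappa; field; rewrite gt_eqF.
have L2' : kappa * b ^+ m.+1 + s * (ln c * b ^+ m.+1) - (2 - 2 * s) * ln c * b / (b - 1)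
   <= (2 - 2 * s) * L m by rewrite -E; apply: L2; lra.
rewrite LS -[m.+1%:R]natr1; move: L2' N2 Hm bm.
rewrite !mulrDr; set X := kappa * _; set Y := kappa * _; set Z := s * (ln c * _).
set W := _ / (b - 1); lra.
Qed.

Lemma hausdorff_dim_Xi_all_ge b c : 1 < b -> 1 < c ->
  ((2 / (b + 1))%:E <= hausdorff_dim cdist (Xi_all b c : set C))%E.
Proof.
move=> b1 c1; apply: hausdorff_dim_ge => [|s sb]; first exact: cdist_ge0.
have [K HK] := box_mass_bound b1 c1 sb.
have s02 : 0 < s < 2.
  case/andP: sb => -> /lt_trans; apply; rewrite ltr_pdivrMr; lra.
have [eta eta0 H] := box_set_cover (@box_radius_ge8 b c) s02 HK.
exists eta => // U d XU; apply: H.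
by apply: subset_trans XU; exact: box_set_sub_Xi_all.
Qed.

Lemma Xi_all_sub_Xi_io b c : (Xi_all b c : set C) `<=` Xi_io b c.
Proof.
move=> z [Dz zall]; split=> //; apply: (@sub_infinite_set _ [set n | (1 <= n)%N]).
  by move=> n /= n1; split=> //; exact: zall.
move=> fin; have := infinite_nat; apply.
have : finite_set ([set n | (1 <= n)%N] `|` [set 0%N]).
  by rewrite finite_setU; split=> //; exact: finite_set1.
by apply: sub_finite_set => -[|n] _; [right|left].
Qed.

End LowerBound.

(** * The dimension formula, from the two bounds and the inclusion of [Xi_all] in [Xi_io] *)

Theorem theorem8p1 (R : realType) (b c : R) (hb : 1 < b) (hc : 1 < c) :
  hausdorff_dim cdist (Xi_io b c) = (2 / (b + 1))%:E /\
  hausdorff_dim cdist (Xi_all b c) = (2 / (b + 1))%:E.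
Proof.
have up : (hausdorff_dim cdist (Xi_io b c) <= (2 / (b + 1))%:E)%E.
  apply: hausdorff_dim_le => [|s sb]; first by rewrite divr_ge0 //; lra.
  exact: hausdorff_measure_Xi_io.
have low := hausdorff_dim_Xi_all_ge hb hc.
have sub := hausdorff_dim_sub cdist (@Xi_all_sub_Xi_io R b c).
split; apply/eqP; rewrite eq_le.
  by rewrite up (le_trans low).
by rewrite low (le_trans sub).
Qed.
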